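(* Near the optimum, where step size $\alpha=1$ is chosen by the line search, EiGLasso with the exact Hessian $H$ converges to the optimum quadratically, and EiGLasso with the approximate Hessian $\hat H$ converges to the optimum linearly.
   Context: $p,q,n\ge1$ are integers. $I_a$ is the $a\times a$ identity, $\otimes$ the Kronecker product, $\Theta\oplus\Psi=\Theta\otimes I_q+I_p\otimes\Psi$, $\operatorname{vec}$ stacks the columns of a matrix, $e_{a,i}$ is the $i$th standard basis vector of $\mathbb{R}^a$, and $\|A\|_{1,\mathrm{off}}=\sum_{i\ne j}|A_{ij}|$. Given data $Y^1,\dots,Y^n\in\mathbb{R}^{q\times p}$ and regularization parameters $\gamma_\Theta,\gamma_\Psi$, set $S=\frac1{nq}\sum_iY^{iT}Y^i$, $T=\frac1{np}\sum_iY^iY^{iT}$, $g(\Theta,\Psi)=q\operatorname{tr}(S\Theta)+p\operatorname{tr}(T\Psi)-\log|\Theta\oplus\Psi|$, $h(\Theta,\Psi)=q\gamma_\Theta\|\Theta\|_{1,\mathrm{off}}+p\gamma_\Psi\|\Psi\|_{1,\mathrm{off}}$, $f=g+h$. ''The optimum'' is the global optimum of the problem of minimizing $f(\Theta,\Psi)$ over symmetric $\Theta\in\mathbb{R}^{p\times p}$, $\Psi\in\mathbb{R}^{q\times q}$ with $\Theta\oplus\Psi\succ0$; it is unique with respect to $\Theta\oplus\Psi$ (the pairs $(\Theta-cI_p,\Psi+cI_q)$, $c\in\mathbb{R}$, have the same Kronecker sum). Gradient and Hessians at $(\Theta,\Psi)$, with $W=(\Theta\oplus\Psi)^{-1}$: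 $G_\Theta=qS-\sum_{i=1}^q(I_p\otimes e_{q,i})^TW(I_p\otimes e_{q,i})$ and $G_\Psi=pT-\sum_{j=1}^p(e_{p,j}\otimes I_q)^TW(e_{p,j}\otimes I_q)$ are the gradients of $g$ in $\Theta$ and $\Psi$, and $\operatorname{vec}(G)=[\operatorname{vec}(G_\Theta)^T,\operatorname{vec}(G_\Psi)^T]^T$. The exact Hessian is $H=P^T(W\otimes W)P$ with $P=[\sum_{i=1}^qI_p\otimes e_{q,i}\otimes I_p\otimes e_{q,i},\ \sum_{j=1}^pe_{p,j}\otimes I_q\otimes e_{p,j}\otimes I_q]$. The approximate Hessian $\hat H$, with integer parameter $K\ge1$, is defined from eigendecompositions $\Theta=Q_\Theta\Lambda_\Theta Q_\Theta^T$, $\Psi=Q_\Psi\Lambda_\Psi Q_\Psi^T$ with eigenvalues $\lambda_{\Theta,k}$, $\lambda_{\Psi,k}$ in increasing order, $\Xi_{\Theta,k}=(\Lambda_\Theta+\lambda_{\Psi,k}I_p)^{-1}$, $\Xi_{\Psi,l}=(\Lambda_\Psi+\lambda_{\Theta,l}I_q)^{-1}$, as the block-diagonal matrix with diagonal blocks $(Q_\Theta\otimes Q_\Theta)\big[\sum_{k=1}^K\Xi_{\Theta,k}\otimes\Xi_{\Theta,k}+(q-K)\Xi_{\Theta,K}\otimes\Xi_{\Theta,K}\big](Q_\Theta\otimes Q_\Theta)^T$ and $(Q_\Psi\otimes Q_\Psi)\big[\sum_{l=1}^K\Xi_{\Psi,l}\otimes\Xi_{\Psi,l}+(p-K)\Xi_{\Psi,K}\otimes\Xi_{\Psi,K}\big](Q_\Psi\otimes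 Q_\Psi)^T$. EiGLasso: initialize $\Theta=I_p$, $\Psi=I_q$. In each iteration, (1) compute $G$ and the Hessian $B$, where $B=H$ (exact version) or $B=\hat H$ (approximate version); (2) determine the active sets $\mathcal A_\Theta=\{(i,j):\Theta_{ij}\ne0\text{ or }|[G_\Theta]_{ij}|>q\gamma_\Theta\}$ and $\mathcal A_\Psi=\{(i,j):\Psi_{ij}\ne0\text{ or }|[G_\Psi]_{ij}|>p\gamma_\Psi\}$; (3) compute the Newton directions $(D_\Theta,D_\Psi)$ by coordinate descent over the active sets (entries outside them being set to zero) for the problem of minimizing over $(\Delta_\Theta,\Delta_\Psi)$ the function $\operatorname{vec}(G)^Tv+\frac12v^TBv+h(\Theta+\Delta_\Theta,\Psi+\Delta_\Psi)$, $v=[\operatorname{vec}(\Delta_\Theta)^T,\operatorname{vec}(\Delta_\Psi)^T]^T$; (4) choose the step size $\alpha$ by line search as the first element of $1,\beta,\beta^2,\dots$ such that $(\Theta+\alpha D_\Theta)\oplus(\Psi+\alpha D_\Psi)\succ0$ and $f(\Theta+\alpha D_\Theta,\Psi+\alpha D_\Psi)\le f(\Theta,\Psi)+\alpha\sigma\delta$, where $0<\sigma<0.5$, $0<\beta<1$ are fixed, $\delta=\operatorname{vec}(D)^T\operatorname{vec}(G)+h(\Theta+D_\Theta,\Psi+D_\Psi)-h(\Theta,\Psi)$ and $\operatorname{vec}(D)=[\operatorname{vec}(D_\Theta)^T,\operatorname{vec}(D_\Psi)^T]^T$; (5) update $\Theta\gets\Theta+\alpha D_\Theta$, $\Psi\gets\Psi+\alpha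 D_\Psi$; (6) check convergence. After convergence, the diagonals are shifted to $(\Theta+cI_p,\Psi-cI_q)$ with $c\in\mathbb{R}$ chosen so that $\operatorname{tr}(\Psi)/\operatorname{tr}(\Theta)$ equals a prescribed ratio. *)

(* Defs.v *)
From HB Require Import structures.
From mathcomp Require Export all_boot all_order all_algebra.
From mathcomp Require Export mxtens.
From mathcomp Require Export all_classical all_reals all_analysis.

Set Implicit Arguments.
Unset Strict Implicit.
Unset Printing Implicit Defensive.

Export Order.TTheory GRing.Theory Num.Theory.
Export numFieldNormedType.Exports.

Local Open Scope classical_set_scope.
Local Open Scope ring_scope.

(* Column stacking: for A : 'M_(m, n), entry k = j * m + i is A i j, in the same
   index convention as the Kronecker product [*t]. *)
Definition vec (R : realType) (m n : nat) (A : 'M[R]_(m, n)) : 'cV[R]_(n * m) :=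
  \col_k A (mxtens_unindex k).2 (mxtens_unindex k).1.

Definition kron_sum (R : realType) (p q : nat) (Theta : 'M[R]_p)
    (Psi : 'M[R]_q) : 'M[R]_(p * q) :=
  Theta *t 1%:M + 1%:M *t Psi.

Definition posdef (R : realType) (d : nat) (A : 'M[R]_d) : Prop :=
  A^T = A /\ forall x : 'cV[R]_d, x != 0 -> 0 < (x^T *m A *m x) 0 0.

Definition l1_off (R : realType) (d : nat) (A : 'M[R]_d) : R :=
  \sum_i \sum_(j | i != j) `|A i j|.

Definition frob (R : realType) (d : nat) (A : 'M[R]_d) : R :=
  Num.sqrt (\sum_i \sum_j A i j ^+ 2).

Definition cov_S (R : realType) (p q n : nat) (Y : 'I_n -> 'M[R]_(q, p)) :
    'M[R]_p :=
  (n * q)%N%:R^-1 *: \sum_i ((Y i)^T *m Y i).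

Definition cov_T (R : realType) (p q n : nat) (Y : 'I_n -> 'M[R]_(q, p)) :
    'M[R]_q :=
  (n * p)%N%:R^-1 *: \sum_i (Y i *m (Y i)^T).

Definition smooth_part (R : realType) (p q n : nat) (Y : 'I_n -> 'M[R]_(q, p))
    (Theta : 'M[R]_p) (Psi : 'M[R]_q) : R :=
  q%:R * \tr (cov_S Y *m Theta) + p%:R * \tr (cov_T Y *m Psi)
  - ln (\det (kron_sum Theta Psi)).

Definition penalty (R : realType) (p q : nat) (gT gP : R)
    (Theta : 'M[R]_p) (Psi : 'M[R]_q) : R :=
  q%:R * gT * l1_off Theta + p%:R * gP * l1_off Psi.

Definition objective (R : realType) (p q n : nat) (Y : 'I_n -> 'M[R]_(q, p))
    (gT gP : R) (Theta : 'M[R]_p) (Psi : 'M[R]_q) : R :=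
  smooth_part Y Theta Psi + penalty gT gP Theta Psi.

Definition feasible (R : realType) (p q : nat) (Theta : 'M[R]_p)
    (Psi : 'M[R]_q) : Prop :=
  [/\ Theta^T = Theta, Psi^T = Psi & posdef (kron_sum Theta Psi)].

Definition is_optimum (R : realType) (p q n : nat) (Y : 'I_n -> 'M[R]_(q, p))
    (gT gP : R) (Theta : 'M[R]_p) (Psi : 'M[R]_q) : Prop :=
  feasible Theta Psi /\
  forall (Theta' : 'M[R]_p) (Psi' : 'M[R]_q), feasible Theta' Psi' ->
    objective Y gT gP Theta Psi <= objective Y gT gP Theta' Psi'.

(* I_p (x) e_{q,i} and e_{p,j} (x) I_q; the casts only rewrite the column
   counts p * 1 and 1 * q as p and q. *)
Definition sel_Theta (R : realType) (p q : nat) (i : 'I_q) :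
    'M[R]_(p * q, p) :=
  castmx (erefl, muln1 p) ((1%:M : 'M[R]_p) *t (delta_mx i 0 : 'cV[R]_q)).

Definition sel_Psi (R : realType) (p q : nat) (j : 'I_p) :
    'M[R]_(p * q, q) :=
  castmx (erefl, mul1n q) ((delta_mx j 0 : 'cV[R]_p) *t (1%:M : 'M[R]_q)).

Definition grad_Theta (R : realType) (p q n : nat) (Y : 'I_n -> 'M[R]_(q, p))
    (Theta : 'M[R]_p) (Psi : 'M[R]_q) : 'M[R]_p :=
  q%:R *: cov_S Y
  - \sum_(i < q) ((sel_Theta R p i)^T *m invmx (kron_sum Theta Psi)
                    *m sel_Theta R p i).

Definition grad_Psi (R : realType) (p q n : nat) (Y : 'I_n -> 'M[R]_(q, p))
    (Theta : 'M[R]_p) (Psi : 'M[R]_q) : 'M[R]_q :=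
  p%:R *: cov_T Y
  - \sum_(j < p) ((sel_Psi R q j)^T *m invmx (kron_sum Theta Psi)
                    *m sel_Psi R q j).

Definition vec2 (R : realType) (p q : nat) (A : 'M[R]_p) (B : 'M[R]_q) :
    'cV[R]_(p * p + q * q) :=
  col_mx (vec A) (vec B).

Definition vec_grad (R : realType) (p q n : nat) (Y : 'I_n -> 'M[R]_(q, p))
    (Theta : 'M[R]_p) (Psi : 'M[R]_q) : 'cV[R]_(p * p + q * q) :=
  vec2 (grad_Theta Y Theta Psi) (grad_Psi Y Theta Psi).

Definition hess_P (R : realType) (p q : nat) :
    'M[R]_((p * q) * (p * q), p * p + q * q) :=
  row_mx (\sum_(i < q) (sel_Theta R p i *t sel_Theta R p i))
         (\sum_(j < p) (sel_Psi R q j *t sel_Psi R q j)).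

Definition exact_hessian (R : realType) (p q : nat) (Theta : 'M[R]_p)
    (Psi : 'M[R]_q) (B : 'M[R]_(p * p + q * q)) : Prop :=
  let W := invmx (kron_sum Theta Psi) in
  B = (hess_P R p q)^T *m (W *t W) *m hess_P R p q.

(* Eigenvalues lam`_0 <= ... <= lam`_(d-1), with multiplicity: lam`_(k-1) is the
   k-th smallest. *)
Definition eigendecomp (R : realType) (d : nat) (A Q : 'M[R]_d)
    (lam : d.-tuple R) : Prop :=
  [/\ Q^T *m Q = 1%:M, sorted <=%R lam
    & A = Q *m diag_mx (\row_i lam`_i) *m Q^T].

Definition Xi (R : realType) (d : nat) (lam : d.-tuple R) (mu : R) : 'M[R]_d :=
  invmx (diag_mx (\row_i lam`_i) + mu%:M).

(* The diagonal block of one factor (size d), where mu lists the eigenvalues of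
   the other factor (size e); meaningful for 1 <= K <= e. *)
Definition approx_block (R : realType) (d e K : nat) (Q : 'M[R]_d)
    (lam : d.-tuple R) (mu : e.-tuple R) : 'M[R]_(d * d) :=
  (Q *t Q)
  *m (\sum_(k < K) (Xi lam mu`_k *t Xi lam mu`_k)
      + (e - K)%N%:R *: (Xi lam mu`_(K.-1) *t Xi lam mu`_(K.-1)))
  *m (Q *t Q)^T.

Definition approx_hessian (R : realType) (p q K : nat) (Theta : 'M[R]_p)
    (Psi : 'M[R]_q) (B : 'M[R]_(p * p + q * q)) : Prop :=
  exists (QT : 'M[R]_p) (lamT : p.-tuple R) (QP : 'M[R]_q) (lamP : q.-tuple R),
    [/\ eigendecomp Theta QT lamT, eigendecomp Psi QP lamP
      & B = block_mx (approx_block K QT lamT lamP) 0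
                     0 (approx_block K QP lamP lamT)].

Definition active_Theta (R : realType) (p q n : nat) (Y : 'I_n -> 'M[R]_(q, p))
    (gT : R) (Theta : 'M[R]_p) (Psi : 'M[R]_q) (i j : 'I_p) : bool :=
  (Theta i j != 0) || (q%:R * gT < `|grad_Theta Y Theta Psi i j|).

Definition active_Psi (R : realType) (p q n : nat) (Y : 'I_n -> 'M[R]_(q, p))
    (gP : R) (Theta : 'M[R]_p) (Psi : 'M[R]_q) (i j : 'I_q) : bool :=
  (Psi i j != 0) || (p%:R * gP < `|grad_Psi Y Theta Psi i j|).

Definition supported (R : realType) (d : nat) (act : 'I_d -> 'I_d -> bool)
    (D : 'M[R]_d) : Prop :=
  forall i j, ~~ act i j -> D i j = 0.

Definition model (R : realType) (p q n : nat) (Y : 'I_n -> 'M[R]_(q, p))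
    (gT gP : R) (B : 'M[R]_(p * p + q * q)) (Theta : 'M[R]_p) (Psi : 'M[R]_q)
    (DT : 'M[R]_p) (DP : 'M[R]_q) : R :=
  let v := vec2 DT DP in
  ((vec_grad Y Theta Psi)^T *m v) 0 0 + 2^-1 * (v^T *m B *m v) 0 0
  + penalty gT gP (Theta + DT) (Psi + DP).

(* The inner solver is idealized: the direction is an exact minimizer of the
   model over the active coordinates.  For the exact Hessian the minimizer is
   unique only up to multiples of (I_p, - I_q); any minimizer is allowed. *)
Definition newton_direction (R : realType) (p q n : nat)
    (Y : 'I_n -> 'M[R]_(q, p)) (gT gP : R) (B : 'M[R]_(p * p + q * q))
    (Theta : 'M[R]_p) (Psi : 'M[R]_q) (DT : 'M[R]_p) (DP : 'M[R]_q) : Prop :=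
  let in_active (ET : 'M[R]_p) (EP : 'M[R]_q) :=
    supported (active_Theta Y gT Theta Psi) ET /\
    supported (active_Psi Y gP Theta Psi) EP in
  in_active DT DP /\
  forall ET EP, in_active ET EP ->
    model Y gT gP B Theta Psi DT DP <= model Y gT gP B Theta Psi ET EP.

Definition step_accepted (R : realType) (p q n : nat)
    (Y : 'I_n -> 'M[R]_(q, p)) (gT gP sigma : R)
    (Theta : 'M[R]_p) (Psi : 'M[R]_q) (DT : 'M[R]_p) (DP : 'M[R]_q)
    (alpha : R) : Prop :=
  let delta := ((vec2 DT DP)^T *m vec_grad Y Theta Psi) 0 0
    + penalty gT gP (Theta + DT) (Psi + DP) - penalty gT gP Theta Psi in
  posdef (kron_sum (Theta + alpha *: DT) (Psi + alpha *: DP)) /\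
  objective Y gT gP (Theta + alpha *: DT) (Psi + alpha *: DP)
    <= objective Y gT gP Theta Psi + alpha * sigma * delta.

Definition line_search (R : realType) (p q n : nat)
    (Y : 'I_n -> 'M[R]_(q, p)) (gT gP sigma beta : R)
    (Theta : 'M[R]_p) (Psi : 'M[R]_q) (DT : 'M[R]_p) (DP : 'M[R]_q)
    (alpha : R) : Prop :=
  exists m : nat,
    [/\ alpha = beta ^+ m,
        step_accepted Y gT gP sigma Theta Psi DT DP (beta ^+ m)
      & forall k, (k < m)%N ->
          ~ step_accepted Y gT gP sigma Theta Psi DT DP (beta ^+ k)].

(* An infinite run, with no stopping test; [hess Theta Psi B] says that B is the
   (exact or approximate) Hessian used at (Theta, Psi).  The final diagonal
   shift is left out: it does not change the Kronecker sum. *)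
Definition eiglasso_run (R : realType) (p q n : nat)
    (Y : 'I_n -> 'M[R]_(q, p)) (gT gP sigma beta : R)
    (hess : 'M[R]_p -> 'M[R]_q -> 'M[R]_(p * p + q * q) -> Prop)
    (Theta : nat -> 'M[R]_p) (Psi : nat -> 'M[R]_q) (alpha : nat -> R) : Prop :=
  [/\ Theta 0%N = 1%:M, Psi 0%N = 1%:M
    & forall t, exists (B : 'M[R]_(p * p + q * q)) (DT : 'M[R]_p) (DP : 'M[R]_q),
      [/\ hess (Theta t) (Psi t) B,
          newton_direction Y gT gP B (Theta t) (Psi t) DT DP,
          line_search Y gT gP sigma beta (Theta t) (Psi t) DT DP (alpha t),
          Theta t.+1 = Theta t + alpha t *: DT
        & Psi t.+1 = Psi t + alpha t *: DP]].

Definition quadratic_cvg (R : realType) (d : nat) (X : nat -> 'M[R]_d)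
    (Xs : 'M[R]_d) : Prop :=
  (frob (X t - Xs) @[t --> \oo] --> (0 : R)) /\
  exists C : R, forall t, frob (X t.+1 - Xs) <= C * frob (X t - Xs) ^+ 2.

(* Linear convergence of the iterates, in a form that does not depend on the
   choice of the norm: a contraction by rho per step, up to a constant M that is
   the same from every iterate on (M = 1 would be a one-step contraction in
   this particular norm). *)
Definition linear_cvg (R : realType) (d : nat) (X : nat -> 'M[R]_d)
    (Xs : 'M[R]_d) : Prop :=
  exists M rho : R, 0 <= rho < 1 /\
    forall s t, frob (X (s + t)%N - Xs) <= M * rho ^+ t * frob (X s - Xs).

Definition qlinear_cvg (R : realType) (u : nat -> R) (l : R) : Prop :=
  exists rho : R, 0 <= rho < 1 /\
    forall t, `|u t.+1 - l| <= rho * `|u t - l|.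

(* Main.v *)
(** Write [X], [X'] and [Xo] for the Kronecker sums at the current iterate, at
    the next iterate and at the optimum.  Close to the optimum, a suitable
    diagonal shift of the optimum differs from the iterate by a pair [e]
    supported on the active set, so the first-order conditions of the restricted
    model and of the optimum may be tested against each other; their sum no
    longer contains the penalty and bounds the error [w] of the step by
      [w^T H w <= e^T H w - tr (X^-1 (Xo - X) Xo^-1 (Xo - X'))].
    For the exact Hessian the right-hand side is
      [tr (X^-1 (Xo - X) X^-1 (Xo - X) Xo^-1 (Xo - X'))],
    which is quadratic in [Xo - X].  The approximate Hessian is only bounded
    between two positive multiples of the identity, uniformly near the optimum;
    this gives [|X' - Xo| = O(|X - Xo|)] and [f' - f* = O(|X - Xo|^2)], and the
    sufficient decrease condition with unit step, combined with the growth
    [f - f* >= mu |X - Xo|^2], contracts [f - f*] by a constant factor. *)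
Require Import Defs.
From mathcomp Require Import ring lra.

Set Implicit Arguments.
Unset Strict Implicit.
Unset Printing Implicit Defensive.

Local Open Scope classical_set_scope.
Local Open Scope ring_scope.

(** * Frobenius inner product and norm *)

Section FrobeniusNorm.
Context {R : realType}.

Definition fdot m n (A B : 'M[R]_(m, n)) : R := \sum_i \sum_j A i j * B i j.

Definition fnorm m n (A : 'M[R]_(m, n)) : R :=
  Num.sqrt (\sum_i \sum_j A i j ^+ 2).

Lemma fdot_tr m n (A B : 'M[R]_(m, n)) : fdot A B = \tr (A^T *m B).
Proof.
rewrite /mxtrace /fdot exchange_big; apply: eq_bigr => j _.
by rewrite mxE; apply: eq_bigr => i _; rewrite mxE.
Qed.

Lemma fdot_sq m n (A : 'M[R]_(m, n)) : fdot A A = fnorm A ^+ 2.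
Proof.
rewrite sqr_sqrtr; last by do 2!apply: sumr_ge0 => ? _; rewrite sqr_ge0.
by apply: eq_bigr => i _; apply: eq_bigr => j _; rewrite expr2.
Qed.

Lemma fnorm_ge0 m n (A : 'M[R]_(m, n)) : 0 <= fnorm A.
Proof. exact: sqrtr_ge0. Qed.

Lemma fdotC m n (A B : 'M[R]_(m, n)) : fdot A B = fdot B A.
Proof. by apply: eq_bigr => i _; apply: eq_bigr => j _; rewrite mulrC. Qed.

Lemma fdotDl m n (A B C : 'M[R]_(m, n)) : fdot (A + B) C = fdot A C + fdot B C.
Proof. by rewrite !fdot_tr linearD mulmxDl linearD. Qed.

Lemma fdotZl m n a (A C : 'M[R]_(m, n)) : fdot (a *: A) C = a * fdot A C.
Proof. by rewrite !fdot_tr linearZ /= -scalemxAl linearZ. Qed.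

Lemma fdotDr m n (A B C : 'M[R]_(m, n)) : fdot C (A + B) = fdot C A + fdot C B.
Proof. by rewrite !(fdotC C) fdotDl. Qed.

Lemma fdotZr m n a (A C : 'M[R]_(m, n)) : fdot C (a *: A) = a * fdot C A.
Proof. by rewrite !(fdotC C) fdotZl. Qed.

Lemma fdot0r m n (C : 'M[R]_(m, n)) : fdot C 0 = 0.
Proof. by rewrite -(scale0r 0) fdotZr mul0r. Qed.

Lemma fnorm_eq0 m n (A : 'M[R]_(m, n)) : (fnorm A == 0) = (A == 0).
Proof.
rewrite -sqrf_eq0 -fdot_sq; apply/eqP/eqP => [A0 | ->]; last exact: fdot0r.
have ge0 (i : 'I_m) : true -> 0 <= \sum_j A i j * A i j.
  by move=> _; apply: sumr_ge0 => j _; rewrite -expr2 sqr_ge0.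
apply/matrixP => i j; rewrite mxE; apply/eqP; rewrite -sqrf_eq0 expr2; apply/eqP.
have Ai0 : \sum_j A i j * A i j = 0 by exact: (psumr_eq0P ge0 A0).
by apply: (psumr_eq0P _ Ai0) => // k _; rewrite -expr2 sqr_ge0.
Qed.

Lemma fnormZ m n a (A : 'M[R]_(m, n)) : fnorm (a *: A) = `|a| * fnorm A.
Proof.
apply/eqP; rewrite -(@eqrXn2 _ 2) ?mulr_ge0 ?fnorm_ge0 //.
by rewrite exprMn -!fdot_sq fdotZl fdotZr real_normK ?num_real // mulrA expr2.
Qed.

Lemma fnormN m n (A : 'M[R]_(m, n)) : fnorm (- A) = fnorm A.
Proof. by rewrite -scaleN1r fnormZ normrN1 mul1r. Qed.

Lemma fnormBC m n (A B : 'M[R]_(m, n)) : fnorm (A - B) = fnorm (B - A).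
Proof. by rewrite -fnormN opprB. Qed.

Lemma fdot_le m n (A B : 'M[R]_(m, n)) : fdot A B <= fnorm A * fnorm B.
Proof.
have [/eqP|B0] := eqVneq (fnorm B) 0.
  by rewrite fnorm_eq0 => /eqP ->; rewrite fdot0r mulr_ge0 ?fnorm_ge0.
have Bgt0 : 0 < fnorm B by rewrite lt_neqAle eq_sym B0 fnorm_ge0.
have /(fun h => le_trans h _) : fdot A B <= `|fdot A B| by exact: ler_norm.
apply; rewrite -(@ler_pXn2r _ 2) ?nnegrE ?mulr_ge0 ?fnorm_ge0 //.
rewrite real_normK ?num_real // exprMn.
set a := fnorm A; set b := fnorm B; set c := fdot A B.
(* The squared norm of this combination equals [b ^+ 2] times the gap in the Cauchy-Schwarz
   inequality; hence the separate treatment of [fnorm B = 0]. *)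
have : 0 <= fnorm (b ^+ 2 *: A + (- c) *: B) ^+ 2 by rewrite sqr_ge0.
rewrite -fdot_sq !(fdotDl, fdotDr, fdotZl, fdotZr) !fdot_sq (fdotC B) -/a -/b -/c.
rewrite [X in 0 <= X -> _](_ : _ = b ^+ 2 * (a ^+ 2 * b ^+ 2 - c ^+ 2));
  last by ring.
by rewrite pmulr_rge0 ?exprn_gt0 // subr_ge0.
Qed.

Lemma fnormD m n (A B : 'M[R]_(m, n)) : fnorm (A + B) <= fnorm A + fnorm B.
Proof.
rewrite -(@ler_pXn2r _ 2) ?nnegrE ?addr_ge0 ?fnorm_ge0 //.
rewrite -fdot_sq !(fdotDl, fdotDr) !fdot_sq (fdotC B).
have := fdot_le A B; nra.
Qed.

Lemma fnorm_trmx m n (A : 'M[R]_(m, n)) : fnorm A^T = fnorm A.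
Proof.
rewrite /fnorm exchange_big; congr Num.sqrt.
by apply: eq_bigr => i _; apply: eq_bigr => j _; rewrite mxE.
Qed.

(** Each entry of the product is an inner product of a row of [A] with a column of [B]. Applying
    Cauchy-Schwarz entrywise makes the double sum of squares factor. *)
Lemma fnormM m n k (A : 'M[R]_(m, n)) (B : 'M[R]_(n, k)) :
  fnorm (A *m B) <= fnorm A * fnorm B.
Proof.
rewrite -(@ler_pXn2r _ 2) ?nnegrE ?mulr_ge0 ?fnorm_ge0 // exprMn.
have sumE a b (C : 'M[R]_(a, b)) : fnorm C ^+ 2 = \sum_i fnorm (row i C) ^+ 2.
  rewrite -fdot_sq; apply: eq_bigr => i _; rewrite -fdot_sq /fdot big_ord1.
  by apply: eq_bigr => j _; rewrite !mxE.
rewrite -fdot_sq {1}/fdot (sumE _ _ A) -(fnorm_trmx B) sumE mulr_suml.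
apply: ler_sum => i _; rewrite mulr_sumr; apply: ler_sum => j _.
have -> : (A *m B) i j = fdot (row i A) (row j B^T).
  by rewrite mxE /fdot big_ord1; apply: eq_bigr => l _; rewrite !mxE.
rewrite -expr2 -exprMn -[X in X <= _]real_normK ?num_real //.
rewrite ler_pXn2r ?nnegrE ?mulr_ge0 ?fnorm_ge0 // ler_norml fdot_le andbT.
rewrite lerNl; apply: le_trans (_ : fdot (- row i A) (row j B^T) <= _).
  by rewrite -(scaleN1r (row i A)) fdotZl mulN1r.
by rewrite (le_trans (fdot_le _ _)) // fnormN.
Qed.

Lemma entry_le_fnorm m n (A : 'M[R]_(m, n)) i j : `|A i j| <= fnorm A.
Proof.
rewrite -(@ler_pXn2r _ 2) ?nnegrE ?fnorm_ge0 // real_normK ?num_real //.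
rewrite -fdot_sq {1}/fdot (bigD1 i) //= (bigD1 j) //= expr2 -addrA lerDl.
apply: addr_ge0; apply: sumr_ge0 => k _; first by rewrite -expr2 sqr_ge0.
by apply: sumr_ge0 => l _; rewrite -expr2 sqr_ge0.
Qed.

Lemma fnorm_sq_le m n (A : 'M[R]_(m, n)) c :
  (forall i j, `|A i j| <= c) -> fnorm A ^+ 2 <= (m * n)%:R * c ^+ 2.
Proof.
move=> Ac; rewrite -fdot_sq.
apply: le_trans (_ : \sum_(i < m) \sum_(j < n) c ^+ 2 <= _).
  apply: ler_sum => i _; apply: ler_sum => j _.
  rewrite -expr2 -real_normK ?num_real // ler_pXn2r ?nnegrE //.
  exact: le_trans (Ac i j).
by rewrite !sumr_const !card_ord -mulrnA mulr_natl mulnC.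
Qed.

Lemma trmul_le m n (A : 'M[R]_(m, n)) (B : 'M[R]_(n, m)) :
  \tr (A *m B) <= fnorm A * fnorm B.
Proof. by rewrite -{1}(trmxK A) -fdot_tr (le_trans (fdot_le _ _)) // fnorm_trmx. Qed.

Lemma quadE n (A : 'M[R]_n) (x y : 'cV[R]_n) : (x^T *m A *m y) 0 0 = fdot x (A *m y).
Proof. by rewrite fdot_tr -mulmxA /mxtrace big_ord1. Qed.

Lemma fdot_mull m n k (A : 'M[R]_(m, n)) (x : 'M[R]_(n, k)) y :
  fdot (A *m x) y = fdot x (A^T *m y).
Proof. by rewrite !fdot_tr trmx_mul mulmxA. Qed.

Lemma fdot_delta n (A : 'M[R]_n) i j :
  fdot (delta_mx i 0 : 'cV_n) (A *m delta_mx j 0) = A i j.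
Proof.
rewrite -colE /fdot (bigD1 i) //= big_ord1 big1 ?addr0 => [|k /negPf ki].
  by rewrite !mxE !eqxx mul1r.
by rewrite big1 // => l _; rewrite mxE ki mul0r.
Qed.

Lemma fnorm_delta n (i : 'I_n) : fnorm (delta_mx i 0 : 'cV[R]_n) = 1.
Proof.
apply/eqP; rewrite -(@eqrXn2 _ 2) ?fnorm_ge0 // -fdot_sq -[X in fdot _ X]mul1mx.
by rewrite fdot_delta mxE eqxx expr1n.
Qed.

End FrobeniusNorm.

(** * Positive definite matrices and concavity of log det *)

Section PositiveDefinite.
Context {R : realType}.

Lemma posdef_quad d (A : 'M[R]_d) (x : 'cV_d) :
  posdef A -> x != 0 -> 0 < fdot x (A *m x).
Proof. by move=> [_ Apos] x0; rewrite -quadE; exact: Apos. Qed.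

Lemma posdef_diag_gt0 d (A : 'M[R]_d) i : posdef A -> 0 < A i i.
Proof.
move=> Apd; rewrite -fdot_delta; apply: posdef_quad => //.
by rewrite -fnorm_eq0 fnorm_delta oner_eq0.
Qed.

Lemma posdef_congr d (A L : 'M[R]_d) :
  L \in unitmx -> posdef A -> posdef (L^T *m A *m L).
Proof.
move=> Lu Apd; split; first by rewrite !trmx_mul trmxK Apd.1 mulmxA.
move=> x x0; rewrite quadE -!mulmxA -{1}(trmxK L) -fdot_mull trmxK.
rewrite posdef_quad //; apply: contra_neq x0 => Lx0.
by rewrite -(mulKmx Lu x) Lx0 mulmx0.
Qed.

Lemma posdef_segment d (A B : 'M[R]_d) :
  posdef A -> posdef B -> forall s : R, 0 <= s <= 1 -> posdef (A + s *: (B - A)).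
Proof.
move=> Apd Bpd s s01; split; first by rewrite linearD linearZ /= linearB /= Apd.1 Bpd.1.
move=> x x0; rewrite quadE.
rewrite (_ : A + s *: (B - A) = (1 - s) *: A + s *: B); last first.
  by rewrite scalerBr scalerBl scale1r addrA addrAC.
rewrite mulmxDl fdotDr -!scalemxAl !fdotZr.
have := posdef_quad Apd x0; have := posdef_quad Bpd x0; nra.
Qed.

(** Induction on the size: splitting off the first row and column leaves the Schur complement [S],
    which is again positive definite and is factored by the induction hypothesis. *)
Lemma cholesky d (A : 'M[R]_d) : posdef A ->
  exists L : 'M[R]_d, [/\ is_trig_mx L, forall i, 0 < L i i & A = L *m L^T].
Proof.
elim: d A => [|d IH] A Apd.
  by exists 0; split=> [||]; [exact: mx0_is_trig | case | apply/matrixP; case].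
pose A' : 'M[R]_(1 + d) := A.
pose a := A 0 0; have a_gt0 : 0 < a by exact: posdef_diag_gt0.
pose r := dlsubmx A'; pose C := drsubmx A'.
have A'T : A'^T = A' by exact: Apd.1.
have AE : A' = block_mx a%:M r^T r C.
  rewrite -{1}(submxK A') /r /C [ulsubmx A']mx11_scalar; congr block_mx.
    by apply/matrixP => i j; rewrite !ord1 !mxE /a; congr (A _ _); apply/val_inj.
  by rewrite trmx_dlsub A'T.
have CT : C^T = C by rewrite /C trmx_drsub A'T.
pose S := C - a^-1 *: (r *m r^T).
have Spd : posdef S.
  split; first by rewrite linearB linearZ /= trmx_mul trmxK CT.
  (* With [x] fixed as the lower part, this [u] minimizes the form of [A'] over the first
     coordinate, and the minimum is the form of [S] at [x]. *)
  move=> x x0; pose u : 'M[R]_1 := - a^-1 *: (r^T *m x).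
  have y0 : (col_mx u x : 'cV_(1 + d)) != 0.
    by apply: contra_neq x0 => y0; rewrite -(col_mxKd u x) y0 linear0.
  have : 0 < ((col_mx u x)^T *m A' *m col_mx u x) 0 0 by exact: Apd.2.
  rewrite AE tr_col_mx mul_row_block mul_row_col.
  have -> : u^T = - a^-1 *: (x^T *m r) by rewrite /u linearZ /= trmx_mul trmxK.
  rewrite mul_mx_scalar scalerA mulrN mulfV ?gt_eqF // scaleN1r addNr mul0mx add0r.
  congr (0 < _ _ _).
  by rewrite /S mulmxBr [in RHS]mulmxBl mulmxDl addrC -!scalemxAl -!scalemxAr
    -scalemxAl !mulmxA scaleNr.
have [L' [L'trig L'pos SE]] := IH S Spd.
have sa : Num.sqrt a != 0 by rewrite gt_eqF // sqrtr_gt0.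
have sa2 : Num.sqrt a * Num.sqrt a = a by rewrite -expr2 sqr_sqrtr // ltW.
pose L : 'M[R]_(1 + d) := block_mx (Num.sqrt a)%:M 0 ((Num.sqrt a)^-1 *: r) L'.
exists L; split.
- suff: is_trig_mx L by [].
  by rewrite is_trig_block_mx // eqxx L'trig andbT mx11_is_trig.
- move=> i; suff: 0 < L i i by [].
  rewrite /L; case: (split_ordP (i : 'I_(1 + d))) => j ->.
    by rewrite block_mxEul ord1 mxE eqxx mulr1n sqrtr_gt0.
  by rewrite block_mxEdr.
- suff: A' = L *m L^T by [].
  rewrite AE /L tr_block_mx trmx0 mulmx_block !mulmx0 !mul0mx !addr0.
  rewrite tr_scalar_mx -scalar_mxM sa2 mul_scalar_mx linearZ /= scalerA mulfV //.
  rewrite scale1r mul_mx_scalar scalerA mulfV // scale1r -scalemxAl -scalemxAr scalerA.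
  by rewrite -invfM sa2 -SE /S addrCA subrr addr0.
Qed.

Lemma posdef_det_gt0 d (A : 'M[R]_d) : posdef A -> 0 < \det A.
Proof.
move=> /cholesky[L [Ltrig Lpos ->]]; rewrite det_mulmx det_tr (det_trig Ltrig).
by rewrite mulr_gt0 // prodr_gt0.
Qed.

Lemma posdef_unit d (A : 'M[R]_d) : posdef A -> A \in unitmx.
Proof. by move=> /posdef_det_gt0 A0; rewrite unitmxE unitfE gt_eqF. Qed.

Lemma posdef_invT d (A : 'M[R]_d) : posdef A -> (invmx A)^T = invmx A.
Proof. by move=> [AT _]; rewrite trmx_inv AT. Qed.

Lemma posdef_gram d (A : 'M[R]_d) : posdef A ->
  exists2 L : 'M[R]_d, L \in unitmx & A = L *m L^T.
Proof.
move=> Apd; have Au := posdef_unit Apd.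
have [L [_ _ AE]] := cholesky Apd; exists L => //.
by move: Au; rewrite AE unitmx_mul => /andP[].
Qed.

(** In terms of the Cholesky factor the determinant is the product of the [L i i ^+ 2], each at most
    [expR (L i i ^+ 2 - 1)], while the trace is the sum of the squares of all entries of [L]. *)
Lemma ln_det_le_tr d (A : 'M[R]_d) : posdef A -> ln (\det A) <= \tr A - d%:R.
Proof.
move=> Apd; have det0 := posdef_det_gt0 Apd.
rewrite -ler_expR lnK ?posrE //.
have [L [Ltrig Lpos AE]] := cholesky Apd.
rewrite {1}AE det_mulmx det_tr (det_trig Ltrig) -big_split /=.
apply: le_trans (_ : expR (\sum_i (L i i * L i i - 1)) <= _).
  rewrite expR_sum; apply: ler_prod => i _; apply/andP; split.
    by rewrite -expr2 sqr_ge0.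
  by have := expR_ge1Dx (L i i * L i i - 1); rewrite addrC subrK.
rewrite ler_expR sumrB sumr_const card_ord lerD2r // AE.
apply: ler_sum => i _; rewrite mxE (bigD1 i) //= mxE lerDl.
by apply: sumr_ge0 => j _; rewrite mxE -expr2 sqr_ge0.
Qed.

(** Concavity of log det without derivatives: with [A = L *m L^T], the trace bound is applied to the
    congruent matrix with [invmx L] on the left of [B] and its transpose on the right, which has
    determinant [\det B / \det A]. *)
Lemma ln_det_tangent d (A B : 'M[R]_d) : posdef A -> posdef B ->
  ln (\det B) - ln (\det A) <= \tr (invmx A *m (B - A)).
Proof.
move=> Apd Bpd; have Au := posdef_unit Apd.
have [L Lu AE] := posdef_gram Apd.
have Mu : (invmx L)^T \in unitmx by rewrite unitmx_tr unitmx_inv.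
have Cpd := posdef_congr Mu Bpd; rewrite trmxK in Cpd.
have detC : \det (invmx L *m B *m (invmx L)^T) = \det B / \det A.
  rewrite !det_mulmx det_tr AE det_mulmx det_tr det_inv invfM; ring.
have detA := posdef_det_gt0 Apd; have detB := posdef_det_gt0 Bpd.
have := ln_det_le_tr Cpd.
rewrite detC ln_div ?posrE // => /le_trans; apply.
rewrite mxtrace_mulC mulmxA mulmxBr linearB /= mulVmx // mxtrace1.
suff -> : invmx A = (invmx L)^T *m invmx L by exact: lexx.
apply: (can_inj (mulKmx Au)); rewrite mulmxV // {1}AE -mulmxA (mulmxA L^T) trmx_inv.
by rewrite mulmxV ?unitmx_tr // mul1mx mulmxV.
Qed.

Lemma inv_sub d (A B : 'M[R]_d) : A \in unitmx -> B \in unitmx ->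
  invmx A - invmx B = invmx A *m (B - A) *m invmx B.
Proof.
by move=> Au Bu; rewrite mulmxBr mulmxBl mulVmx // mul1mx -mulmxA mulmxV // mulmx1.
Qed.

(** For symmetric [A] this bounds the smallest eigenvalue from below. Stated through the quadratic
    form, it passes directly to segments and perturbations. *)
Definition coercive d (c : R) (A : 'M[R]_d) : Prop :=
  forall x : 'cV[R]_d, c * fnorm x ^+ 2 <= fdot x (A *m x).

Lemma coercive_mx d k c (A : 'M[R]_d) (M : 'M[R]_(d, k)) : coercive c A ->
  c * fnorm M ^+ 2 <= fdot M (A *m M).
Proof.
move=> Ac; have colE' (N : 'M[R]_(d, k)) : fdot M N = \sum_j fdot (col j M) (col j N).
  rewrite /fdot exchange_big; apply: eq_bigr => j _; apply: eq_bigr => i _.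
  by rewrite big_ord1 !mxE.
rewrite -fdot_sq !colE' mulr_sumr; apply: ler_sum => j _.
by rewrite fdot_sq -[X in fdot _ X]mul1mx !colE -!mulmxA mul1mx Ac.
Qed.

(** Factoring [B = L *m L^T] turns the trace into the form of [A] at [M *m L]; the norm of [M *m L]
    is in turn the form of [B] at [M]. *)
Lemma tr_sandwich_ge d a b (A B M : 'M[R]_d) : 0 <= a -> 0 <= b ->
  coercive a A -> coercive b B -> posdef B -> M^T = M ->
  a * b * fnorm M ^+ 2 <= \tr (A *m M *m B *m M).
Proof.
move=> a0 b0 Aa Bb /posdef_gram[L Lu BE] MT.
have -> : \tr (A *m M *m B *m M) = fdot (M *m L) (A *m (M *m L)).
  rewrite fdot_tr trmx_mul MT BE !mulmxA -(mulmxA (A *m M *m L) L^T M).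
  by rewrite mxtrace_mulC !mulmxA.
apply: le_trans (coercive_mx (M *m L) Aa).
rewrite -mulrA ler_wpM2l // -[X in _ <= X]fdot_sq.
have -> : fdot (M *m L) (M *m L) = fdot M (B *m M).
  rewrite !fdot_tr !trmx_mul MT BE !mulmxA -(mulmxA (M *m L) L^T M).
  by rewrite [RHS]mxtrace_mulC !mulmxA.
exact: coercive_mx.
Qed.

Lemma coercive_posdef d c (A : 'M[R]_d) : 0 < c -> A^T = A -> coercive c A -> posdef A.
Proof.
move=> c0 AT Ac; split=> // x x0; rewrite quadE; apply: lt_le_trans (Ac x).
by rewrite mulr_gt0 // exprn_gt0 // lt_neqAle eq_sym fnorm_eq0 x0 fnorm_ge0.
Qed.

(** No compactness is involved: with [A = L *m L^T] the form is the squared norm of [L^T *m x], and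
    [x] is recovered by multiplying with the inverse of [L^T]. The [1 +] in [k] keeps the constant
    positive in dimension zero. *)
Lemma posdef_coercive d (A : 'M[R]_d) : posdef A -> exists2 c, 0 < c & coercive c A.
Proof.
move=> /posdef_gram[L Lu ->]; pose k := (1 + fnorm (invmx L)^T) ^+ 2.
have k0 : 0 < k by rewrite exprn_gt0 // ltr_pwDl ?fnorm_ge0.
exists k^-1; rewrite ?invr_gt0 // => x.
rewrite mulrC ler_pdivrMr // -mulmxA -{1}(trmxK L) -fdot_mull fdot_sq.
rewrite mulrC -exprMn ler_pXn2r ?nnegrE ?fnorm_ge0 //; last first.
  by rewrite mulr_ge0 ?addr_ge0 ?fnorm_ge0.
have LTu : L^T \in unitmx by rewrite unitmx_tr.
rewrite -{1}(mulKmx LTu x) -trmx_inv.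
by rewrite (le_trans (fnormM _ _)) // ler_wpM2r ?fnorm_ge0 // lerDr ler01.
Qed.

(** Coercivity makes [invmx A] shrink vectors by [c], so its columns, hence all its entries, are at
    most [c^-1]; the factor [d] comes from the [d * d] entries. *)
Lemma coercive_inv_norm d c (A : 'M[R]_d) : 0 < c -> A \in unitmx -> coercive c A ->
  fnorm (invmx A) <= d%:R / c.
Proof.
move=> c0 Au Ac.
have colle (y : 'cV[R]_d) : fnorm (invmx A *m y) <= fnorm y / c.
  have := Ac (invmx A *m y); rewrite mulKVmx // => h.
  have h2 := le_trans h (fdot_le _ _).
  rewrite ler_pdivlMr //; have := fnorm_ge0 (invmx A *m y); rewrite le_eqVlt.
  case/orP => [/eqP <- | w0]; first by rewrite mul0r fnorm_ge0.
  by rewrite -(ler_pM2l w0) mulrA -expr2 mulrC.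
have entry i j : `|invmx A i j| <= c^-1.
  apply: le_trans (_ : fnorm (invmx A *m delta_mx j (0 : 'I_1)) <= _); last first.
    by rewrite (le_trans (colle _)) // fnorm_delta mul1r.
  by rewrite -colE; have := entry_le_fnorm (col j (invmx A)) i 0; rewrite mxE.
rewrite -(@ler_pXn2r _ 2) ?nnegrE ?fnorm_ge0 ?divr_ge0 ?ler0n ?(ltW c0) //.
by rewrite (le_trans (fnorm_sq_le entry)) // exprMn natrM expr2.
Qed.

(** Writing [y = A *m x], the form of the inverse at [y] is the form of [A] at [x], and [x] has norm
    at least [fnorm y / b]. *)
Lemma coercive_inv d c b (A : 'M[R]_d) : 0 <= c -> 0 < b -> A \in unitmx ->
  coercive c A -> fnorm A <= b -> coercive (c / b ^+ 2) (invmx A).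
Proof.
move=> c0 b0 Au Ac Ab y; pose x := invmx A *m y.
have yE : y = A *m x by rewrite mulKVmx.
have yle : fnorm y ^+ 2 <= b ^+ 2 * fnorm x ^+ 2.
  rewrite -exprMn ler_pXn2r ?nnegrE ?mulr_ge0 ?fnorm_ge0 ?(ltW b0) // yE.
  by rewrite (le_trans (fnormM _ _)) // ler_wpM2r ?fnorm_ge0.
rewrite -/x fdotC {2}yE; apply: le_trans (Ac x).
rewrite -mulrA ler_wpM2l // mulrC ler_pdivrMr ?exprn_gt0 // mulrC //.
Qed.

Lemma coercive_near d c (A B : 'M[R]_d) : coercive c A ->
  coercive (c - fnorm (B - A)) B.
Proof.
move=> Ac x; rewrite -[in leRHS](subrK A B) mulmxDl fdotDr mulrBl addrC.
apply: lerD => //; rewrite lerNl -mulN1r -fdotZr scaleN1r.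
apply: le_trans (fdot_le _ _) _; rewrite fnormN mulrC expr2 mulrA.
by rewrite ler_wpM2r ?fnorm_ge0 // fnormM.
Qed.

End PositiveDefinite.

(** * Kronecker sums, gradient and Hessians *)

Section Vectorization.
Context {R : realType}.

Lemma sum_mxtens m n (F : 'I_(m * n) -> R) :
  \sum_k F k = \sum_i \sum_j F (mxtens_index (i, j)).
Proof.
rewrite pair_big (reindex (@mxtens_index m n)) /=; first by apply: eq_bigr => -[].
by exists (@mxtens_unindex m n) => i _; rewrite (mxtens_indexK, mxtens_unindexK).
Qed.

Lemma vecE m n (A : 'M[R]_(m, n)) i j k : vec A (mxtens_index (j, i)) k = A i j.
Proof. by rewrite mxE mxtens_indexK. Qed.

Lemma vecD m n (A B : 'M[R]_(m, n)) : vec (A + B) = vec A + vec B.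
Proof. by apply/matrixP => i j; rewrite !mxE. Qed.

Lemma vecZ m n a (A : 'M[R]_(m, n)) : vec (a *: A) = a *: vec A.
Proof. by apply/matrixP => i j; rewrite !mxE. Qed.

Lemma vec_sum m n k (F : 'I_k -> 'M[R]_(m, n)) : vec (\sum_i F i) = \sum_i vec (F i).
Proof. by apply/matrixP => i j; rewrite !(mxE, summxE); apply: eq_bigr => l _; rewrite mxE. Qed.

Lemma fdot_vec m n (A B : 'M[R]_(m, n)) : fdot (vec A) (vec B) = fdot A B.
Proof.
rewrite /fdot sum_mxtens exchange_big; apply: eq_bigr => i _; apply: eq_bigr => j _.
by rewrite big_ord1 !vecE.
Qed.

Lemma tens_vec m n r s (A : 'M[R]_(m, n)) (B : 'M[R]_(r, s)) (C : 'M[R]_(s, n)) :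
  (A *t B) *m vec C = vec (B *m C *m A^T).
Proof.
apply/matrixP => k l; case: (mxtens_indexP k) => j i; rewrite vecE mxE sum_mxtens mxE.
apply: eq_bigr => b _; rewrite mxE mulr_suml; apply: eq_bigr => a _.
by rewrite tensmxE vecE mxE; ring.
Qed.

Lemma vec2D p q (A C : 'M[R]_p) (B D : 'M[R]_q) :
  vec2 (A + C) (B + D) = vec2 A B + vec2 C D.
Proof. by rewrite /vec2 !vecD add_col_mx. Qed.

Lemma vec2Z p q a (A : 'M[R]_p) (B : 'M[R]_q) :
  vec2 (a *: A) (a *: B) = a *: vec2 A B.
Proof. by rewrite /vec2 !vecZ scale_col_mx. Qed.

Lemma fdot_col m n k (A C : 'M[R]_(m, k)) (B D : 'M[R]_(n, k)) :
  fdot (col_mx A B) (col_mx C D) = fdot A C + fdot B D.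
Proof.
rewrite /fdot big_split_ord /=; congr (_ + _); apply: eq_bigr => i _;
  by apply: eq_bigr => j _; rewrite ?col_mxEu ?col_mxEd.
Qed.

Lemma fdot_vec2 p q (A C : 'M[R]_p) (B D : 'M[R]_q) :
  fdot (vec2 A B) (vec2 C D) = fdot A C + fdot B D.
Proof. by rewrite fdot_col !fdot_vec. Qed.

End Vectorization.

Section KroneckerSum.
Context {R : realType} {p q : nat}.
Implicit Types (A T : 'M[R]_p) (B P : 'M[R]_q).

Lemma kron_sumE A B i j k l :
  kron_sum A B (mxtens_index (i, k)) (mxtens_index (j, l)) =
  A i j * (k == l)%:R + (i == j)%:R * B k l.
Proof. by rewrite mxE !tensmxE !mxE. Qed.

Lemma kron_sumD A B T P : kron_sum (A + T) (B + P) = kron_sum A B + kron_sum T P.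
Proof.
apply/matrixP => a b; case: (mxtens_indexP a) => i k; case: (mxtens_indexP b) => j l.
by rewrite [RHS]mxE !kron_sumE !mxE; ring.
Qed.

Lemma kron_sumZ c A B : kron_sum (c *: A) (c *: B) = c *: kron_sum A B.
Proof.
apply/matrixP => a b; case: (mxtens_indexP a) => i k; case: (mxtens_indexP b) => j l.
by rewrite [RHS]mxE !kron_sumE !mxE; ring.
Qed.

Lemma kron_sumB A B T P : kron_sum (A - T) (B - P) = kron_sum A B - kron_sum T P.
Proof. by rewrite kron_sumD -[- T]scaleN1r -[- P]scaleN1r kron_sumZ scaleN1r. Qed.

Lemma kron_sum_shift c A B : kron_sum (A + c%:M) (B - c%:M) = kron_sum A B.
Proof.
apply/matrixP => a b; case: (mxtens_indexP a) => i k; case: (mxtens_indexP b) => j l.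
rewrite !kron_sumE !mxE; case: (i == j); case: (k == l); rewrite /= ?mulr1n ?mulr0n; ring.
Qed.

Lemma fnorm_kron_sum A B :
  fnorm (kron_sum A B) ^+ 2 <= (p * q * (p * q))%:R * 4 * fnorm (vec2 A B) ^+ 2.
Proof.
apply: le_trans (fnorm_sq_le (c := 2 * fnorm (vec2 A B)) _) _; last first.
  by rewrite exprMn mulrA (_ : 2 ^+ 2 = 4 :> R) //; ring.
move=> a b; case: (mxtens_indexP a) => i k; case: (mxtens_indexP b) => j l.
rewrite kron_sumE (le_trans (ler_normD _ _)) //.
rewrite (_ : 2 * fnorm _ = fnorm (vec2 A B) + fnorm (vec2 A B)); last by ring.
have leA : `|A i j| <= fnorm (vec2 A B).
  have := entry_le_fnorm (vec2 A B) (lshift _ (mxtens_index (j, i))) 0.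
  by rewrite col_mxEu vecE.
have leB : `|B k l| <= fnorm (vec2 A B).
  have := entry_le_fnorm (vec2 A B) (rshift _ (mxtens_index (l, k))) 0.
  by rewrite col_mxEd vecE.
apply: lerD; rewrite normrM ?normr_nat.
- by case: (k == l); rewrite ?mulr1 ?mulr0 ?fnorm_ge0.
- by case: (i == j); rewrite ?mul1r ?mul0r ?fnorm_ge0.
Qed.

Lemma sel_ThetaE (i : 'I_q) a k b :
  sel_Theta R p i (mxtens_index (a, k)) b = ((a == b) && (k == i))%:R :> R.
Proof.
rewrite castmxE /= cast_ord_id.
have -> : cast_ord (esym (muln1 p)) b = mxtens_index (b, 0 : 'I_1).
  by apply: val_inj; rewrite /= muln1 addn0.
by rewrite tensmxE !mxE eqxx andbT -natrM mulnb.
Qed.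

Lemma sel_PsiE (j : 'I_p) a k l :
  sel_Psi R q j (mxtens_index (a, k)) l = ((a == j) && (k == l))%:R :> R.
Proof.
rewrite castmxE /= cast_ord_id.
have -> : cast_ord (esym (mul1n q)) l = mxtens_index (0 : 'I_1, l).
  by apply: val_inj; rewrite /= mul0n add0n.
by rewrite tensmxE !mxE eqxx andbT -natrM mulnb.
Qed.

Lemma sum_pick n (F : 'I_n -> R) i (b : bool) :
  \sum_j ((i == j) && b)%:R * F j = b%:R * F i.
Proof.
rewrite (bigD1 i) //= eqxx big1 ?addr0 // => j /negPf; rewrite eq_sym => ->.
by rewrite mul0r.
Qed.

(** The map [A *t 1%:M] is the adjoint of the sum of diagonal blocks occurring in [grad_Theta]; this
    form lets the trace of a block sum be moved to the full Kronecker space. *)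
Lemma sum_sel_Theta A :
  \sum_(i < q) (sel_Theta R p i *m A *m (sel_Theta R p i)^T) = A *t 1%:M.
Proof.
apply/matrixP => a b; case: (mxtens_indexP a) => x k; case: (mxtens_indexP b) => y l.
rewrite tensmxE !mxE summxE.
transitivity (\sum_i ((k == i) && (l == i))%:R * A x y).
  apply: eq_bigr => i _; rewrite mxE.
  transitivity (\sum_j ((y == j) && (l == i))%:R * ((k == i)%:R * A x j)).
    apply: eq_bigr => j _; rewrite !mxE sel_ThetaE mulrC; congr (_ * _).
    rewrite -(sum_pick (fun z => A z j) x); apply: eq_bigr => z _.
    by rewrite sel_ThetaE.
  by rewrite sum_pick mulrA -natrM mulnb andbC.
rewrite -mulr_suml mulrC; congr (_ * _).
have := sum_pick (fun i => (l == i)%:R) k true; rewrite mul1r eq_sym => <-.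
by apply: eq_bigr => i _; rewrite andbT -natrM mulnb.
Qed.

Lemma sum_sel_Psi B :
  \sum_(j < p) (sel_Psi R q j *m B *m (sel_Psi R q j)^T) = 1%:M *t B.
Proof.
apply/matrixP => a b; case: (mxtens_indexP a) => x k; case: (mxtens_indexP b) => y l.
rewrite tensmxE !mxE summxE.
transitivity (\sum_i ((x == i) && (y == i))%:R * B k l).
  apply: eq_bigr => i _; rewrite mxE.
  transitivity (\sum_j ((l == j) && (y == i))%:R * ((x == i)%:R * B k j)).
    apply: eq_bigr => j _; rewrite !mxE sel_PsiE mulrC andbC; congr (_ * _).
    rewrite -(sum_pick (fun z => B z j) k); apply: eq_bigr => z _.
    by rewrite sel_PsiE andbC.
  by rewrite sum_pick mulrA -natrM mulnb andbC.
rewrite -mulr_suml; congr (_ * _).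
have := sum_pick (fun i => (y == i)%:R) x true; rewrite mul1r eq_sym => <-.
by apply: eq_bigr => i _; rewrite andbT -natrM mulnb.
Qed.

(** Identifies [hess_P] as the matrix of the linear map forming Kronecker sums, so that the exact
    Hessian is a pullback of the form of [W *t W] and sees a direction only through its Kronecker
    sum. *)
Lemma hess_P_vec2 A B : hess_P R p q *m vec2 A B = vec (kron_sum A B).
Proof.
rewrite /hess_P mul_row_col !mulmx_suml /kron_sum vecD -sum_sel_Theta -sum_sel_Psi !vec_sum.
by congr (_ + _); apply: eq_bigr => i _; rewrite tens_vec.
Qed.

End KroneckerSum.

(** * Gradient of the smooth part as a linear form *)

Section Gradient.
Context {R : realType} {p q n : nat}.
Variable Y : 'I_n -> 'M[R]_(q, p).

Definition data_lin (A : 'M[R]_p) (B : 'M[R]_q) : R :=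
  q%:R * \tr (cov_S Y *m A) + p%:R * \tr (cov_T Y *m B).

(* The derivative of the smooth part at a point with [W] the inverse of the
   Kronecker sum. *)
Definition dsmooth (W : 'M[R]_(p * q)) (A : 'M[R]_p) (B : 'M[R]_q) : R :=
  data_lin A B - \tr (W *m kron_sum A B).

Lemma data_linD A B T P : data_lin (A + T) (B + P) = data_lin A B + data_lin T P.
Proof. by rewrite /data_lin !mulmxDr !mxtraceD !mulrDr addrACA. Qed.

Lemma data_linZ c A B : data_lin (c *: A) (c *: B) = c * data_lin A B.
Proof. by rewrite /data_lin -!scalemxAr !mxtraceZ !(mulrCA _ c) -mulrDr. Qed.

(** Both [q%:R * \tr (cov_S Y)] and [p%:R * \tr (cov_T Y)] equal the mean squared Frobenius norm of
    the data, so the two contributions of the shift cancel. *)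
Lemma data_lin_shift c A B : (0 < p)%N -> (0 < q)%N -> (0 < n)%N ->
  data_lin (A + c%:M) (B - c%:M) = data_lin A B.
Proof.
move=> p0 q0 n0; suff E : q%:R * \tr (cov_S Y) = p%:R * \tr (cov_T Y).
  rewrite data_linD /data_lin; move: (cov_S Y) (cov_T Y) E => S T E.
  rewrite mulmxN !mul_mx_scalar linearN /= !mxtraceZ.
  by rewrite mulrN !(mulrCA _ c) E subrr addr0.
rewrite !mxtraceZ !mulrA !natrM !invfM !(mulrCA _ n%:R^-1) !mulfV ?pnatr_eq0 -?lt0n //.
rewrite !linear_sum /=; congr (_ * _); apply: eq_bigr => i _; exact: mxtrace_mulC.
Qed.

Lemma dsmoothZ W c A B : dsmooth W (c *: A) (c *: B) = c * dsmooth W A B.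
Proof. by rewrite /dsmooth data_linZ kron_sumZ -scalemxAr mxtraceZ -mulrBr. Qed.

Lemma cov_S_tr : (cov_S Y)^T = cov_S Y.
Proof.
rewrite linearZ linear_sum /=; congr (_ *: _); apply: eq_bigr => i _.
by rewrite trmx_mul trmxK.
Qed.

Lemma cov_T_tr : (cov_T Y)^T = cov_T Y.
Proof.
rewrite linearZ linear_sum /=; congr (_ *: _); apply: eq_bigr => i _.
by rewrite trmx_mul trmxK.
Qed.

Lemma fdot_vec_grad T P A B : (kron_sum T P)^T = kron_sum T P ->
  fdot (vec_grad Y T P) (vec2 A B) = dsmooth (invmx (kron_sum T P)) A B.
Proof.
move=> symX; set W := invmx _; have WT : W^T = W by rewrite trmx_inv symX.
have sandwich m (s : 'M[R]_(p * q, m)) (C : 'M[R]_m) :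
    \tr ((s^T *m W *m s)^T *m C) = \tr (W *m (s *m C *m s^T)).
  by rewrite !trmx_mul trmxK WT -[s^T *m _ *m C]mulmxA mxtrace_mulC !mulmxA.
have gT : fdot (grad_Theta Y T P) A = q%:R * \tr (cov_S Y *m A) - \tr (W *m (A *t 1%:M)).
  rewrite fdot_tr /grad_Theta linearB linearZ /= cov_S_tr mulmxBl -scalemxAl.
  rewrite linearB linearZ /=; congr (_ - _).
  rewrite -sum_sel_Theta mulmx_sumr !linear_sum /= mulmx_suml linear_sum.
  by apply: eq_bigr => i _; rewrite /= -/W sandwich.
have gP : fdot (grad_Psi Y T P) B = p%:R * \tr (cov_T Y *m B) - \tr (W *m (1%:M *t B)).
  rewrite fdot_tr /grad_Psi linearB linearZ /= cov_T_tr mulmxBl -scalemxAl.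
  rewrite linearB linearZ /=; congr (_ - _).
  rewrite -sum_sel_Psi mulmx_sumr !linear_sum /= mulmx_suml linear_sum.
  by apply: eq_bigr => i _; rewrite /= -/W sandwich.
by rewrite fdot_vec2 gT gP /dsmooth /data_lin /kron_sum mulmxDr mxtraceD opprD addrACA.
Qed.

End Gradient.

Section ExactHessian.
Context {R : realType} {p q : nat}.

Lemma exact_hessianE (T A C : 'M[R]_p) (P B D : 'M[R]_q) H :
  posdef (kron_sum T P) -> exact_hessian T P H ->
  let W := invmx (kron_sum T P) in
  fdot (vec2 A B) (H *m vec2 C D) =
  \tr ((kron_sum A B)^T *m (W *m kron_sum C D *m W)).
Proof.
move=> Xpd ->; rewrite /= -!mulmxA -fdot_mull !hess_P_vec2.
by rewrite tens_vec fdot_vec fdot_tr (posdef_invT Xpd) !mulmxA.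
Qed.

Lemma exact_hessian_tr (T : 'M[R]_p) (P : 'M[R]_q) H :
  posdef (kron_sum T P) -> exact_hessian T P H -> H^T = H.
Proof.
by move=> Xpd ->; rewrite !trmx_mul trmxK trmx_tens (posdef_invT Xpd) mulmxA.
Qed.

End ExactHessian.

(** * Spectral bounds for the approximate Hessian *)

Section ApproximateHessian.
Context {R : realType}.

Lemma tens1 m n : (1%:M : 'M[R]_m) *t (1%:M : 'M[R]_n) = 1%:M.
Proof.
apply/matrixP => a b; case: (mxtens_indexP a) => i k; case: (mxtens_indexP b) => j l.
rewrite tensmxE !mxE (can_eq (@mxtens_indexK m n)) xpair_eqE -natrM mulnb //.
Qed.

Lemma tens_diag m n (a : 'rV[R]_m) (b : 'rV[R]_n) :
  diag_mx a *t diag_mx b =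
  diag_mx (\row_k (a 0 (mxtens_unindex k).1 * b 0 (mxtens_unindex k).2)).
Proof.
apply/matrixP => x y; case: (mxtens_indexP x) => i k; case: (mxtens_indexP y) => j l.
rewrite tensmxE !mxE (can_eq (@mxtens_indexK m n)) xpair_eqE mxtens_indexK /=.
by case: (i == j); case: (k == l); rewrite /= ?mulr1n ?mulr0n ?mulr0 ?mul0r.
Qed.

Lemma XiE d (lam : d.-tuple R) mu : (forall i : 'I_d, lam`_i + mu != 0) ->
  Xi lam mu = diag_mx (\row_(i < d) (lam`_i + mu)^-1).
Proof.
move=> nz; set D := diag_mx _.
have E : (diag_mx (\row_(i < d) lam`_i) + mu%:M) *m D = 1%:M.
  apply/matrixP => i j; rewrite mul_mx_diag !mxE.
  case: eqVneq => [-> | _]; last by rewrite !mulr0n addr0 mul0r.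
  by rewrite !mulr1n mulfV.
have [Mu _] := mulmx1_unit E.
by rewrite -[RHS](mulKmx Mu) E mulmx1.
Qed.

Lemma fdot_diag d (w : 'rV[R]_d) (x : 'cV[R]_d) :
  fdot x (diag_mx w *m x) = \sum_i w 0 i * x i 0 ^+ 2.
Proof.
by apply: eq_bigr => i _; rewrite big_ord1 mul_diag_mx !mxE; ring.
Qed.

Lemma fnorm_cV d (x : 'cV[R]_d) : fnorm x ^+ 2 = \sum_i x i 0 ^+ 2.
Proof. by rewrite -fdot_sq; apply: eq_bigr => i _; rewrite big_ord1 expr2. Qed.

Lemma orthogonal_tr d (Q : 'M[R]_d) : Q^T *m Q = 1%:M -> Q *m Q^T = 1%:M.
Proof. exact: mulmx1C. Qed.

Lemma fnorm_orthogonal d k (Q : 'M[R]_d) (M : 'M[R]_(d, k)) : Q^T *m Q = 1%:M ->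
  fnorm (Q *m M) ^+ 2 = fnorm M ^+ 2.
Proof. by move=> QQ; rewrite -!fdot_sq fdot_mull mulmxA QQ mul1mx. Qed.

Lemma tens_orthogonal m n (Q : 'M[R]_m) (U : 'M[R]_n) :
  Q^T *m Q = 1%:M -> U^T *m U = 1%:M -> (Q *t U)^T *m (Q *t U) = 1%:M.
Proof. by move=> QQ UU; rewrite trmx_tens tensmx_mul QQ UU tens1. Qed.

(** The columns of [QT *t QP] are unit eigenvectors of the Kronecker sum with eigenvalues [lamT]_i +
    lamP[_k]; the two bounds on the Kronecker sum are evaluated there. *)
Lemma eigen_bounds p q (T QT : 'M[R]_p) (P QP : 'M[R]_q) lamT lamP m b
    (i : 'I_p) (k : 'I_q) :
  eigendecomp T QT lamT -> eigendecomp P QP lamP ->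
  coercive m (kron_sum T P) -> fnorm (kron_sum T P) <= b ->
  m <= lamT`_i + lamP`_k <= b.
Proof.
move=> [QQ _ TE] [UU _ PE] mX Xb; set X := kron_sum T P in mX Xb.
pose V := QT *t QP; have VV : V^T *m V = 1%:M by exact: tens_orthogonal.
pose x : 'cV[R]_(p * q) := V *m delta_mx (mxtens_index (i, k)) 0.
have x1 : fnorm x ^+ 2 = 1 by rewrite fnorm_orthogonal // fnorm_delta expr1n.
have XE : fdot x (X *m x) = lamT`_i + lamP`_k.
  rewrite fdot_mull !mulmxA fdot_delta.
  have -> : V^T *m X *m V =
      kron_sum (diag_mx (\row_(i < p) lamT`_i)) (diag_mx (\row_(k < q) lamP`_k)).
    rewrite /X /kron_sum mulmxDr mulmxDl trmx_tens !tensmx_mul !mulmx1 QQ UU.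
    congr (_ *t _ + _ *t _).
      by rewrite TE !mulmxA QQ mul1mx -mulmxA QQ mulmx1.
    by rewrite PE !mulmxA UU mul1mx -mulmxA UU mulmx1.
  by rewrite kron_sumE !mxE !eqxx !mulr1n mulr1 mul1r.
apply/andP; split; first by have := mX x; rewrite x1 mulr1 XE.
rewrite -XE (le_trans (fdot_le _ _)) // -[b]mulr1 -x1 expr2 mulrA mulrC.
rewrite ler_wpM2r ?fnorm_ge0 // (le_trans (fnormM _ _)) // ler_wpM2r ?fnorm_ge0 //.
Qed.

Lemma approx_blockE d e K (Q : 'M[R]_d) (lam : d.-tuple R) (mu : e.-tuple R) :
  (0 < K <= e)%N ->
  (forall (i : 'I_d) (k : 'I_e), lam`_i + mu`_k != 0) ->
  approx_block K Q lam mu = (Q *t Q) *m diag_mx (\row_a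
    (\sum_(k < K) ((lam`_(mxtens_unindex a).1 + mu`_k)^-1
                     * (lam`_(mxtens_unindex a).2 + mu`_k)^-1)
    + (e - K)%:R * ((lam`_(mxtens_unindex a).1 + mu`_K.-1)^-1
                    * (lam`_(mxtens_unindex a).2 + mu`_K.-1)^-1)))
  *m (Q *t Q)^T.
Proof.
move=> /andP[K0 Ke] nz; rewrite /approx_block; congr (_ *m _ *m _).
have XX k : (k < e)%N -> Xi lam mu`_k *t Xi lam mu`_k = diag_mx (\row_a
    ((lam`_(mxtens_unindex a).1 + mu`_k)^-1 * (lam`_(mxtens_unindex a).2 + mu`_k)^-1)).
  move=> ke; rewrite XiE => [|i]; last exact: (nz i (Ordinal ke)).
  by rewrite tens_diag; congr diag_mx; apply/rowP => a; rewrite !mxE.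
under eq_bigr => k _ do rewrite XX ?(leq_trans (ltn_ord k)) //.
rewrite XX ?(leq_trans _ Ke) ?prednK //.
apply/matrixP => a c; rewrite !mxE summxE mulrnDl; congr (_ + _).
  by rewrite -sumrMnl; apply: eq_bigr => k _; rewrite !mxE.
by rewrite mulrnAr.
Qed.

(** In the orthonormal basis [Q *t Q] the block is diagonal, each entry being a sum of [e] products,
    with multiplicity, that lie between [b ^- 2] and [m ^- 2]. The upper bound counts all [e] of
    them, the lower bound keeps one. *)
Lemma approx_block_bounds d e K (Q : 'M[R]_d) (lam : d.-tuple R) (mu : e.-tuple R)
    (m b : R) :
  (0 < K <= e)%N -> 0 < m -> Q^T *m Q = 1%:M ->
  (forall (i : 'I_d) (k : 'I_e), m <= lam`_i + mu`_k <= b) ->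
  [/\ (approx_block K Q lam mu)^T = approx_block K Q lam mu,
      coercive (b ^- 2) (approx_block K Q lam mu)
    & forall x : 'cV_(d * d),
        fdot x (approx_block K Q lam mu *m x) <= e%:R / m ^+ 2 * fnorm x ^+ 2].
Proof.
move=> Kbnd m0 QQ bnd; have pos i k : 0 < lam`_(i : 'I_d) + mu`_(k : 'I_e).
  by have /andP[+ _] := bnd i k; exact: lt_le_trans.
rewrite approx_blockE // => [|i k]; last by rewrite gt_eqF.
set w := \row__ _; have /andP[K0 Ke] := Kbnd.
have VV := tens_orthogonal QQ QQ; set V := Q *t Q in VV *.
have VV' : (V^T)^T *m V^T = 1%:M by rewrite trmxK; exact: orthogonal_tr.
have wbnd a : b ^- 2 <= w 0 a <= e%:R / m ^+ 2.
  case: (mxtens_indexP a) => i j.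
  have term (k : 'I_e) : b ^- 2 <= (lam`_i + mu`_k)^-1 * (lam`_j + mu`_k)^-1 <= m ^- 2.
    have /andP[mi ib] := bnd i k; have /andP[mj jb] := bnd j k.
    have b0 : 0 < b by exact: lt_le_trans (pos i k) ib.
    rewrite -invfM; apply/andP; split;
      rewrite lef_pV2 ?posrE ?mulr_gt0 ?exprn_gt0 ?pos // expr2.
      by rewrite ler_pM // ltW.
    by rewrite ler_pM // ltW.
  have termK k : (k < e)%N ->
      b ^- 2 <= (lam`_i + mu`_k)^-1 * (lam`_j + mu`_k)^-1 <= m ^- 2.
    by move=> ke; exact: (term (Ordinal ke)).
  rewrite mxE mxtens_indexK /=.
  (* Position [K.-1] holds the [K]-th smallest eigenvalue; being below [e], it does not reach the
     default value of the tuple access. *)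
  have Kp : (K.-1 < e)%N by rewrite (leq_trans _ Ke) ?prednK.
  have /andP[t1 t2] := termK _ Kp.
  have eE : e%:R = K%:R + (e - K)%:R :> R by rewrite -natrD subnKC.
  apply/andP; split.
    have b2 : 0 <= b ^- 2 by rewrite -exprVn sqr_ge0.
    apply: ler_wpDr; first by rewrite mulr_ge0 ?ler0n // (le_trans b2).
    apply: le_trans (_ : \sum_(k < K) b ^- 2 <= _).
      by rewrite sumr_const card_ord -(prednK K0) mulrS lerDl mulrn_wge0.
    by apply: ler_sum => k _; have /andP[] := termK k (leq_trans (ltn_ord k) Ke).
  rewrite eE mulrDl lerD //; last by rewrite ler_wpM2l ?ler0n.
  rewrite mulr_natl -[X in _ *+ X]card_ord -sumr_const.
  apply: ler_sum => k _; by have /andP[] := termK k (leq_trans (ltn_ord k) Ke).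
split.
- by rewrite !trmx_mul trmxK tr_diag_mx mulmxA.
- move=> x; rewrite -!mulmxA -{1}(trmxK V) -fdot_mull fdot_diag.
  rewrite -(fnorm_orthogonal x VV') fnorm_cV mulr_sumr; apply: ler_sum => a _.
  by rewrite ler_wpM2r ?sqr_ge0 //; have /andP[] := wbnd a.
- move=> x; rewrite -!mulmxA -{1}(trmxK V) -fdot_mull fdot_diag.
  rewrite -(fnorm_orthogonal x VV') fnorm_cV mulr_sumr; apply: ler_sum => a _.
  by rewrite ler_wpM2r ?sqr_ge0 //; have /andP[] := wbnd a.
Qed.

Lemma approx_hessian_bounds p q K (T : 'M[R]_p) (P : 'M[R]_q) B (m b : R) :
  (1 <= K)%N -> (K <= p)%N -> (K <= q)%N -> 0 < m ->
  coercive m (kron_sum T P) -> fnorm (kron_sum T P) <= b ->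
  approx_hessian K T P B ->
  [/\ B^T = B, coercive (b ^- 2) B
    & forall x : 'cV_(p * p + q * q),
        fdot x (B *m x) <= (p + q)%:R / m ^+ 2 * fnorm x ^+ 2].
Proof.
move=> K0 Kp Kq m0 mX Xb [QT [lamT [QP [lamP [eT eP ->]]]]].
have bnd i k : m <= lamT`_(i : 'I_p) + lamP`_(k : 'I_q) <= b.
  exact: eigen_bounds eT eP mX Xb.
have bnd' k i : m <= lamP`_(k : 'I_q) + lamT`_(i : 'I_p) <= b by rewrite addrC.
have K0q : (0 < K <= q)%N by rewrite K0.
have K0p : (0 < K <= p)%N by rewrite K0.
have [QQ _ _] := eT; have [UU _ _] := eP.
have [ST cT uT] := approx_block_bounds K0q m0 QQ bnd.
have [SP cP uP] := approx_block_bounds K0p m0 UU bnd'.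
have fnorm_col (x : 'cV[R]_(p * p + q * q)) :
    fnorm x ^+ 2 = fnorm (usubmx x) ^+ 2 + fnorm (dsubmx x) ^+ 2.
  by rewrite -!fdot_sq -{1 2}(vsubmxK x) fdot_col.
have quad (x : 'cV[R]_(p * p + q * q)) BT BP : fdot x (block_mx BT 0 0 BP *m x) =
    fdot (usubmx x) (BT *m usubmx x) + fdot (dsubmx x) (BP *m dsubmx x).
  by rewrite -{1 2}(vsubmxK x) mul_block_col !mul0mx addr0 add0r fdot_col.
have m2 : 0 <= m ^- 2 by rewrite -exprVn sqr_ge0.
split; first by rewrite tr_block_mx !trmx0 ST SP.
- by move=> x; rewrite quad fnorm_col mulrDr lerD.
- move=> x; rewrite quad fnorm_col natrD mulrDr; apply: lerD.
    apply: le_trans (uT _) _; rewrite ler_wpM2r ?sqr_ge0 // ler_wpM2r //.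
    by rewrite lerDr ler0n.
  apply: le_trans (uP _) _; rewrite ler_wpM2r ?sqr_ge0 // ler_wpM2r //.
  by rewrite lerDl ler0n.
Qed.

End ApproximateHessian.

(** * First-order conditions *)

Section Objective.
Context {R : realType}.

(** Stands in for the limit as [s] tends to [0] from above when first-order conditions are derived
    from minimality along segments. *)
Lemma ge0_limit (a c : R) : (forall s, 0 < s <= 1 -> 0 <= a + s * c) -> 0 <= a.
Proof.
move=> h; rewrite leNgt; apply/negP => a0.
(* Large enough that [s = - a / k] is admissible and that [k > c]; at this [s] the hypothesis reads
   [0 <= a * (k - c)] up to a positive factor. *)
pose k := 2 * (1 + `|a| + `|c|).
have ck : c < k by have := normr_ge0 a; have := normr_ge0 c; have := ler_norm c; rewrite /k; lra.
have k0 : 0 < k by have := normr_ge0 a; have := normr_ge0 c; rewrite /k; lra.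
have s01 : 0 < (- a) / k <= 1.
  rewrite divr_gt0 ?oppr_gt0 //= ler_pdivrMr // mul1r.
  by rewrite /k (ltr0_norm a0); have := normr_ge0 c; lra.
have := h _ s01; rewrite -(pmulr_rge0 _ k0) mulrDr mulrA mulrCA mulfV ?gt_eqF //.
nra.
Qed.

Lemma coercive_le d (c c' : R) (A : 'M[R]_d) : c' <= c -> coercive c A -> coercive c' A.
Proof. by move=> cc Ac x; apply: le_trans (Ac x); rewrite ler_wpM2r ?sqr_ge0. Qed.

Lemma coercive_segment d (c s : R) (A B : 'M[R]_d) : 0 <= s <= 1 ->
  coercive c A -> coercive c B -> coercive c (A + s *: (B - A)).
Proof.
move=> s01 Ac Bc x.
rewrite (_ : A + s *: (B - A) = (1 - s) *: A + s *: B); last first.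
  by rewrite scalerBr scalerBl scale1r addrA addrAC.
rewrite mulmxDl fdotDr -!scalemxAl !fdotZr.
have := Ac x; have := Bc x; set u := c * _; nra.
Qed.

Lemma tr4_le d (A M B N : 'M[R]_d) :
  \tr (A *m M *m B *m N) <= fnorm A * fnorm M * fnorm B * fnorm N.
Proof.
apply: le_trans (trmul_le _ _) _; rewrite ler_wpM2r ?fnorm_ge0 //.
apply: le_trans (fnormM _ _) _; rewrite ler_wpM2r ?fnorm_ge0 //; exact: fnormM.
Qed.

Lemma l1_off_convex d (A B : 'M[R]_d) s : 0 <= s <= 1 ->
  l1_off (A + s *: (B - A)) <= l1_off A + s * (l1_off B - l1_off A).
Proof.
move=> /andP[s0 s1].
have -> : l1_off A + s * (l1_off B - l1_off A) = (1 - s) * l1_off A + s * l1_off B by ring.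
rewrite /l1_off !mulr_sumr -big_split; apply: ler_sum => i _ /=.
rewrite !mulr_sumr -big_split; apply: ler_sum => j _ /=; rewrite !mxE.
have -> : A i j + s * (B i j - A i j) = (1 - s) * A i j + s * B i j by ring.
by rewrite (le_trans (ler_normD _ _)) // !normrM (ger0_norm s0) ger0_norm ?subr_ge0.
Qed.

Lemma l1_off_shift d (A : 'M[R]_d) c : l1_off (A + c%:M) = l1_off A.
Proof.
by apply: eq_bigr => i _; apply: eq_bigr => j /negPf ij; rewrite !mxE ij mulr0n addr0.
Qed.

Context {p q n : nat}.
Variables (Y : 'I_n -> 'M[R]_(q, p)) (gT gP : R).
Hypotheses (gT0 : 0 <= gT) (gP0 : 0 <= gP).
Implicit Types (T A C DT : 'M[R]_p) (P B D DP : 'M[R]_q).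

Lemma penalty_convex A B C D s : 0 <= s <= 1 ->
  penalty gT gP (A + s *: (C - A)) (B + s *: (D - B)) <=
  penalty gT gP A B + s * (penalty gT gP C D - penalty gT gP A B).
Proof.
move=> s01; rewrite /penalty.
have := ler_wpM2l (mulr_ge0 (ler0n R q) gT0) (l1_off_convex A C s01).
have := ler_wpM2l (mulr_ge0 (ler0n R p) gP0) (l1_off_convex B D s01).
lra.
Qed.

Lemma objectiveE T P : objective Y gT gP T P =
  data_lin Y T P - ln (\det (kron_sum T P)) + penalty gT gP T P.
Proof. by []. Qed.

Lemma optimum_shift T P c : (0 < p)%N -> (0 < q)%N -> (0 < n)%N ->
  is_optimum Y gT gP T P -> is_optimum Y gT gP (T + c%:M) (P - c%:M).
Proof.
move=> p0 q0 n0 [[TT PT Xpd] opt]; split.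
  split; last by rewrite kron_sum_shift.
    by rewrite linearD /= TT tr_scalar_mx.
  by rewrite linearB /= PT tr_scalar_mx.
move=> T' P' /opt; rewrite !objectiveE data_lin_shift // kron_sum_shift.
by rewrite /penalty -!raddfN /= !l1_off_shift.
Qed.

(** Minimality is compared with a point [Xs] of the segment, using convexity of the penalty and the
    tangent of log det at [Xs]. Replacing the inverse at [Xs] by that at [X] costs a multiple of
    [s], which [ge0_limit] removes. *)
Lemma optimum_variational T P C D : is_optimum Y gT gP T P -> feasible C D ->
  0 <= dsmooth Y (invmx (kron_sum T P)) (C - T) (D - P)
       + (penalty gT gP C D - penalty gT gP T P).
Proof.
move=> [[TT PT Xpd] opt] [CT DT Ypd]; set X := kron_sum T P in Xpd *.
set X' := kron_sum C D in Ypd; set M := kron_sum (C - T) (D - P).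
have ME : M = X' - X by exact: kron_sumB.
have [c1 c1_0 X1] := posdef_coercive Xpd; have [c2 c2_0 X2] := posdef_coercive Ypd.
(* A coercivity constant common to both endpoints, hence to the whole segment; it makes the
   remainder bound [k] independent of [s]. *)
pose c := Num.min c1 c2; have c0 : 0 < c by rewrite lt_min c1_0.
pose k := ((p * q)%:R / c) ^+ 2 * fnorm M ^+ 2.
have cX : coercive c X by apply: coercive_le X1; rewrite ge_min lexx.
apply: (@ge0_limit _ k) => s s01; have /andP[s0 s1] := s01.
have s01' : 0 <= s <= 1 by rewrite ltW.
pose Ts := T + s *: (C - T); pose Ps := P + s *: (D - P).
pose Xs := kron_sum Ts Ps; have XsE : Xs = X + s *: M by rewrite /Xs kron_sumD kron_sumZ.
have cXs : coercive c Xs.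
  rewrite XsE ME; apply: coercive_segment => //.
  by apply: coercive_le X2; rewrite ge_min lexx orbT.
have Xspd : posdef Xs by rewrite XsE ME; exact: posdef_segment.
have := opt Ts Ps; rewrite !objectiveE.
have fs : feasible Ts Ps.
  by split=> //; rewrite linearD linearZ /= linearB /= ?TT ?PT ?CT ?DT.
move=> /(_ fs); rewrite -/X -/Xs data_linD data_linZ => le1.
have le2 := penalty_convex T P C D s01'.
have le3 := ln_det_tangent Xspd Xpd.
have XsB : X - Xs = - s *: M by rewrite XsE opprD addrA subrr add0r scaleNr.
rewrite XsB -scalemxAr mxtraceZ in le3.
have Xu := posdef_unit Xpd; have Xsu := posdef_unit Xspd.
have WE : \tr (invmx X *m M) - \tr (invmx Xs *m M) =
    s * \tr (invmx X *m M *m invmx Xs *m M).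
  have XsX : Xs - X = s *: M by rewrite XsE [X + _]addrC addrK.
  rewrite -raddfB /= -mulmxBl inv_sub // XsX.
  by rewrite -scalemxAr -!scalemxAl mxtraceZ.
have le4 : \tr (invmx X *m M *m invmx Xs *m M) <= k.
  apply: le_trans (tr4_le _ _ _ _) _.
  rewrite -mulrA [_ * fnorm M * _]mulrACA -!expr2 /k ler_wpM2r ?sqr_ge0 //.
  by rewrite expr2 ler_pM ?fnorm_ge0 // coercive_inv_norm.
rewrite /dsmooth -/M.
suff : 0 <= s * (data_lin Y (C - T) (D - P) - \tr (invmx X *m M) +
   (penalty gT gP C D - penalty gT gP T P) + s * k) by rewrite pmulr_rge0.
have le5 := ler_wpM2l (ltW s0) (ler_wpM2l (ltW s0) le4).
have := congr1 ( *%R s) WE; nra.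
Qed.

Lemma modelE T P H DT DP :
  model Y gT gP H T P DT DP = fdot (vec_grad Y T P) (vec2 DT DP)
   + 2^-1 * fdot (vec2 DT DP) (H *m vec2 DT DP) + penalty gT gP (T + DT) (P + DP).
Proof. by rewrite /model quadE [fdot (vec_grad _ _ _) _]fdot_tr /mxtrace big_ord1. Qed.

(** Minimality of the model along the segment towards [(C, D)], which stays inside the active
    coordinates. The smooth part is quadratic, so the second-order term in [s] is exact. *)
Lemma newton_variational H T P DT DP C D : H^T = H ->
  newton_direction Y gT gP H T P DT DP ->
  supported (active_Theta Y gT T P) C -> supported (active_Psi Y gP T P) D ->
  0 <= fdot (vec_grad Y T P) (vec2 (C - DT) (D - DP))
       + fdot (vec2 DT DP) (H *m vec2 (C - DT) (D - DP))
       + (penalty gT gP (T + C) (P + D) - penalty gT gP (T + DT) (P + DP)).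
Proof.
move=> HT [[sT sP] min] sC sD; set v := vec2 DT DP; set u := vec2 (C - DT) _.
apply: (@ge0_limit _ (2^-1 * fdot u (H *m u))) => s s01; have /andP[s0 s1] := s01.
have s01' : 0 <= s <= 1 by rewrite ltW.
have := min (DT + s *: (C - DT)) (DP + s *: (D - DP)).
have sup : supported (active_Theta Y gT T P) (DT + s *: (C - DT)) /\
    supported (active_Psi Y gP T P) (DP + s *: (D - DP)).
  by split=> i j ij; rewrite !mxE ?sT ?sP ?sC ?sD // subrr mulr0 addr0.
move=> /(_ sup); rewrite !modelE vec2D vec2Z -/v -/u !(mulmxDr, fdotDl, fdotDr).
rewrite -!scalemxAr !(fdotZl, fdotZr).
have -> : fdot u (H *m v) = fdot v (H *m u) by rewrite fdotC fdot_mull HT.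
have := penalty_convex (T + DT) (P + DP) (T + C) (P + D) s01'.
have sub2 k (Z E F : 'M[R]_k) : Z + F - (Z + E) = F - E.
  by rewrite opprD addrACA subrr add0r.
rewrite !sub2 (addrA T) (addrA P).
move=> le1 le2.
set g := fdot _ u; rewrite -/g in le2.
suff : 0 <= s * (g + fdot v (H *m u) + (penalty gT gP (T + C) (P + D) -
   penalty gT gP (T + DT) (P + DP)) + s * (2^-1 * fdot u (H *m u))).
  by rewrite pmulr_rge0.
nra.
Qed.

End Objective.

(** * Choice of the diagonal shift *)

Section Gauge.
Context {R : realType}.

Lemma separation_radius (I : finType) (F : I -> R) :
  exists2 r, 0 < r & forall i, `|F i| < r -> F i = 0.
Proof.
(* The sum of inverses replaces a minimum over the nonzero values: zero values contribute
   [0^-1 = 0], and each nonzero one satisfies [s^-1 < |F i|]. *)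
pose s := 1 + \sum_i `|F i|^-1.
have sum0 : 0 <= \sum_i `|F i|^-1 by apply: sumr_ge0 => i _; rewrite invr_ge0.
have s0 : 0 < s by rewrite ltr_pwDl.
exists s^-1; rewrite ?invr_gt0 // => i.
have [//|Fi] := eqVneq (F i) 0.
rewrite -[X in X < _ -> _]invrK ltf_pV2 ?posrE ?invr_gt0 ?normr_gt0 // => sF.
suff : `|F i|^-1 < s by rewrite ltNge ltW.
rewrite /s (bigD1 i) //= addrCA ltrDl ltr_pwDl //.
by apply: sumr_ge0 => j _; rewrite invr_ge0.
Qed.

Context {p q : nat}.
Hypotheses (p0 : (0 < p)%N) (q0 : (0 < q)%N).

Lemma kron_sum_offl (A : 'M[R]_p) (B : 'M[R]_q) i j k : i != j ->
  kron_sum A B (mxtens_index (i, k)) (mxtens_index (j, k)) = A i j.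
Proof. by move=> /negPf ij; rewrite kron_sumE eqxx ij mulr1 mul0r addr0. Qed.

Lemma kron_sum_offr (A : 'M[R]_p) (B : 'M[R]_q) i k l : k != l ->
  kron_sum A B (mxtens_index (i, k)) (mxtens_index (i, l)) = B k l.
Proof. by move=> /negPf kl; rewrite kron_sumE eqxx kl mulr0 mul1r add0r. Qed.

Lemma kron_sum_diag (A : 'M[R]_p) (B : 'M[R]_q) i k :
  kron_sum A B (mxtens_index (i, k)) (mxtens_index (i, k)) = A i i + B k k.
Proof. by rewrite kron_sumE !eqxx mulr1 mul1r. Qed.

(** A vanishing diagonal entry in one factor exposes the diagonal of the other in the Kronecker sum,
    and subtracting recovers the remaining diagonal at the cost of a factor [2]. Off-diagonal
    entries appear unchanged. *)
Lemma kron_sum_inj_diag0 (A : 'M[R]_p) (B : 'M[R]_q) :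
  (exists i, A i i = 0) \/ (exists k, B k k = 0) ->
  fnorm (vec2 A B) ^+ 2 <= ((p * p + q * q) * 1)%:R * 4 * fnorm (kron_sum A B) ^+ 2.
Proof.
pose N := fnorm (kron_sum A B) => AB0.
have N0 : 0 <= N by exact: fnorm_ge0.
have entry a b : `|kron_sum A B a b| <= N by exact: entry_le_fnorm.
have sumle i k : `|A i i + B k k| <= N by rewrite -kron_sum_diag.
have diag : (forall i, `|A i i| <= 2 * N) /\ (forall k, `|B k k| <= 2 * N).
  case: AB0 => -[i0 i00].
    have B1 k : `|B k k| <= N by have := sumle i0 k; rewrite i00 add0r.
    split=> [i|k]; last by have := B1 k; lra.
    have := sumle i (Ordinal q0); have := B1 (Ordinal q0); move: (B _ _) => y.
    by rewrite !ler_norml; lra.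
  have A1 i : `|A i i| <= N by have := sumle i i0; rewrite i00 addr0.
  split=> [i|k]; first by have := A1 i; lra.
  have := sumle (Ordinal p0) k; have := A1 (Ordinal p0); move: (A _ _) => y.
  by rewrite !ler_norml; lra.
have le2 x : `|x| <= N -> `|x| <= 2 * N by move=> ?; lra.
have leA i j : `|A i j| <= 2 * N.
  have [<-|ij] := eqVneq i j; first exact: diag.1.
  by apply: le2; rewrite -(kron_sum_offl A B (Ordinal q0) ij).
have leB k l : `|B k l| <= 2 * N.
  have [<-|kl] := eqVneq k l; first exact: diag.2.
  by apply: le2; rewrite -(kron_sum_offr A B (Ordinal p0) kl).
apply: le_trans (fnorm_sq_le (c := 2 * N) _) _ => [a b|]; last first.
  by rewrite exprMn mulrA (_ : 2 ^+ 2 = 4 :> R) //; ring.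
by case: (split_ordP a) => c ->; case: (mxtens_indexP c) => i j;
  rewrite ?col_mxEu ?col_mxEd vecE.
Qed.

(* Only differences of diagonal entries of the factors are determined by the
   Kronecker sum, so the shift is chosen to match a vanishing diagonal entry of
   the current factors, if there is one: close to the optimum, all vanishing
   entries are then already correct. *)
Lemma optimum_gauge (To : 'M[R]_p) (Po : 'M[R]_q) :
  exists2 r, 0 < r & forall (T : 'M[R]_p) (P : 'M[R]_q),
    posdef (kron_sum T P) -> fnorm (kron_sum T P - kron_sum To Po) < r ->
    exists c, let A := To + c%:M - T in let B := Po - c%:M - P in
    [/\ forall i j, T i j = 0 -> A i j = 0,
        forall k l, P k l = 0 -> B k l = 0
      & fnorm (vec2 A B) ^+ 2 <=
        ((p * p + q * q) * 1)%:R * 4 * fnorm (kron_sum A B) ^+ 2].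
Proof.
set Xo := kron_sum To Po.
have [r1 r1_0 sep1] := separation_radius
  (fun ab : 'I_(p * q) * 'I_(p * q) => Xo ab.1 ab.2).
have [r2 r2_0 sep2] := separation_radius
  (fun ab : 'I_(p * q) * 'I_(p * q) => Xo ab.1 ab.1 - Xo ab.2 ab.2).
(* Within [r1], a zero of [X] is a zero of [Xo]; within [r2 / 2], equal diagonal entries of [X] are
   equal in [Xo], the half accounting for the errors of two entries. *)
exists (Num.min r1 (r2 / 2)); first by rewrite lt_min r1_0 divr_gt0.
move=> T P Xpd; set X := kron_sum T P in Xpd *; rewrite lt_min => /andP[lt1 lt2].
have entry a b : `|X a b - Xo a b| <= fnorm (X - Xo).
  by have := entry_le_fnorm (X - Xo) a b; rewrite !mxE.
have off a b : X a b = 0 -> Xo a b = 0.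
  move=> Xab; apply: (sep1 (a, b)); apply: le_lt_trans lt1.
  by have := entry a b; rewrite Xab add0r normrN.
have dia a b : X a a = X b b -> Xo a a = Xo b b.
  move=> Xab; apply/eqP; rewrite -subr_eq0; apply/eqP; apply: (sep2 (a, b)) => /=.
  have := entry a a; have := entry b b; rewrite Xab.
  by move: lt2; rewrite ltr_pdivlMr // ltr_norml !ler_norml; lra.
have offT i j : i != j -> T i j = 0 -> To i j = 0.
  move=> ij; rewrite -(kron_sum_offl T P (Ordinal q0) ij) => /off.
  by rewrite /Xo kron_sum_offl.
have offP k l : k != l -> P k l = 0 -> Po k l = 0.
  move=> kl; rewrite -(kron_sum_offr T P (Ordinal p0) kl) => /off.
  by rewrite /Xo kron_sum_offr.
(* Consequently the diagonals of [T] and [P] cannot both contain a zero, so a single shift never has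
   to serve both factors. *)
have pos i k : 0 < T i i + P k k.
  by rewrite -kron_sum_diag; exact: posdef_diag_gt0.
have diaT i j : T i i = T j j -> To i i = To j j.
  move=> Tij; have : X (mxtens_index (i, Ordinal q0)) (mxtens_index (i, Ordinal q0)) =
      X (mxtens_index (j, Ordinal q0)) (mxtens_index (j, Ordinal q0)).
    by rewrite /X !kron_sum_diag Tij.
  by move=> /dia; rewrite /Xo !kron_sum_diag => /addIr.
have diaP i j : P i i = P j j -> Po i i = Po j j.
  move=> Pij; have : X (mxtens_index (Ordinal p0, i)) (mxtens_index (Ordinal p0, i)) =
      X (mxtens_index (Ordinal p0, j)) (mxtens_index (Ordinal p0, j)).
    by rewrite /X !kron_sum_diag Pij.
  by move=> /dia; rewrite /Xo !kron_sum_diag => /addrI.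
suff [c [cT cP cE]] : exists c, [/\ forall i, T i i = 0 -> To i i + c = 0,
    forall k, P k k = 0 -> Po k k - c = 0
  & (exists i, To i i + c - T i i = 0) \/ (exists k, Po k k - c - P k k = 0)].
  exists c; split=> [i j Tij|k l Pkl|].
  - rewrite !mxE Tij subr0; have [ij|ij] := eqVneq i j; last by rewrite offT // addr0.
    by rewrite -ij in Tij *; rewrite mulr1n cT.
  - rewrite !mxE Pkl subr0; have [kl|kl] := eqVneq k l.
      by rewrite -kl in Pkl *; rewrite mulr1n cP.
    by rewrite offP // mulr0n subr0.
  - apply: kron_sum_inj_diag0; case: cE => -[i ci]; [left | right]; exists i;
    by rewrite !mxE eqxx mulr1n.
have [/existsP[i0 /eqP Ti0]|nT] := boolP [exists i, T i i == 0].
  exists (- To i0 i0); split=> [i Ti|k Pk|].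
  - by rewrite (diaT i i0) ?subrr // Ti Ti0.
  - by have := pos i0 k; rewrite Ti0 Pk addr0 ltxx.
  - by left; exists i0; rewrite subrr Ti0 subr0.
have [/existsP[k0 /eqP Pk0]|nP] := boolP [exists k, P k k == 0].
  exists (Po k0 k0); split=> [i Ti|k Pk|].
  - by have := pos i k0; rewrite Ti Pk0 addr0 ltxx.
  - by rewrite (diaP k k0) ?subrr // Pk Pk0.
  - by right; exists k0; rewrite subrr Pk0 subr0.
(* No diagonal entry vanishes here, so the shift is free; it is used to make one diagonal entry of
   the difference zero, as the norm estimate requires. *)
have i0 := Ordinal p0; exists (T i0 i0 - To i0 i0); split=> [i Ti|k Pk|].
- by move/existsPn: nT => /(_ i); rewrite Ti eqxx.
- by move/existsPn: nP => /(_ k); rewrite Pk eqxx.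
- by left; exists i0; rewrite addrCA subrr addr0 subrr.
Qed.

End Gauge.

(** * One Newton step *)

Section NewtonStep.
Context {R : realType}.

Definition well_conditioned d (m b : R) (X : 'M[R]_d) : Prop :=
  [/\ posdef X, coercive m X & fnorm X <= b].

Lemma well_conditioned_near d (X : 'M[R]_d) : posdef X ->
  exists m b, [/\ 0 < m, 0 < b & forall Z, posdef Z -> fnorm (Z - X) <= m ->
    well_conditioned m b Z].
Proof.
(* Half of the coercivity constant is spent as the radius of the ball and the other half remains as
   the coercivity constant on it. *)
move=> /posdef_coercive[c c0 Xc]; exists (c / 2), (fnorm X + c / 2).
have c2 : 0 < c / 2 by rewrite divr_gt0.
split=> //; first by rewrite ltr_wpDl ?fnorm_ge0.
move=> Z Zpd ZX; split=> //.
  by apply: coercive_le (coercive_near Z Xc); lra.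
by rewrite -[Z](subrK X) addrC (le_trans (fnormD _ _)) // lerD2l.
Qed.

Lemma well_conditioned_inv d (m b : R) (X : 'M[R]_d) : 0 < m -> 0 < b ->
  well_conditioned m b X ->
  fnorm (invmx X) <= d%:R / m /\ coercive (m / b ^+ 2) (invmx X).
Proof.
move=> m0 b0 [Xpd Xm Xb]; have Xu := posdef_unit Xpd.
by split; [exact: coercive_inv_norm | apply: coercive_inv => //; exact: ltW].
Qed.

Lemma posdef_inv d (m b : R) (X : 'M[R]_d) : 0 < m -> 0 < b ->
  well_conditioned m b X -> posdef (invmx X).
Proof.
move=> m0 b0 Xwc; have [_ c] := well_conditioned_inv m0 b0 Xwc.
have [Xpd _ _] := Xwc; apply: (coercive_posdef _ (posdef_invT Xpd) c).
by rewrite divr_gt0 ?exprn_gt0.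
Qed.

Lemma well_conditioned_segment d (m b s : R) (X Z : 'M[R]_d) : 0 <= s <= 1 ->
  well_conditioned m b X -> well_conditioned m b Z ->
  well_conditioned m b (X + s *: (Z - X)).
Proof.
move=> s01 [Xp Xm Xb] [Zp Zm Zb]; split; [exact: posdef_segment | exact: coercive_segment|].
rewrite (_ : X + _ = (1 - s) *: X + s *: Z); last first.
  by rewrite scalerBr scalerBl scale1r addrA addrAC.
have /andP[s0 s1] := s01.
rewrite (le_trans (fnormD _ _)) // !fnormZ !ger0_norm ?subr_ge0 //; nra.
Qed.

(** Tangents are taken at [X] and at the midpoint [Y], each over half of the segment. Their slopes
    differ by a trace that [tr_sandwich_ge] bounds below by a quadratic in [M]. *)
Lemma ln_det_strongly_concave d (m b : R) (X Z : 'M[R]_d) : 0 < m -> 0 < b ->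
  well_conditioned m b X -> well_conditioned m b Z ->
  (m / b ^+ 2) ^+ 2 / 4 * fnorm (Z - X) ^+ 2 <=
  \tr (invmx X *m (Z - X)) - (ln (\det Z) - ln (\det X)).
Proof.
move=> m0 b0 Xwc Zwc; set M := Z - X; set l := m / b ^+ 2.
have h01 : 0 <= (2^-1 : R) <= 1 by apply/andP; split; lra.
have Ywc := well_conditioned_segment h01 Xwc Zwc; set Y := X + 2^-1 *: _ in Ywc.
have [Xpd _ _] := Xwc; have [Zpd _ _] := Zwc; have [Ypd _ _] := Ywc.
have YX : Y - X = 2^-1 *: M by rewrite /Y [X + _]addrC addrK.
have ZY : Z - Y = 2^-1 *: M.
  rewrite /Y opprD addrA -/M -{1}(scale1r M) -scalerBl; congr (_ *: _); lra.
have l0 : 0 <= l by rewrite divr_ge0 ?ltW ?exprn_gt0.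
have t1 := ln_det_tangent Xpd Ypd; have t2 := ln_det_tangent Ypd Zpd.
rewrite YX -scalemxAr mxtraceZ in t1; rewrite ZY -scalemxAr mxtraceZ in t2.
have MT : M^T = M by rewrite linearB /= Xpd.1 Zpd.1.
have [_ cX] := well_conditioned_inv m0 b0 Xwc.
have [_ cY] := well_conditioned_inv m0 b0 Ywc.
have := tr_sandwich_ge l0 l0 cX cY (posdef_inv m0 b0 Ywc) MT.
have : \tr (invmx X *m M) - \tr (invmx Y *m M) =
    2^-1 * \tr (invmx X *m M *m invmx Y *m M).
  rewrite -raddfB /= -mulmxBl inv_sub ?posdef_unit // YX.
  by rewrite -scalemxAr -!scalemxAl mxtraceZ.
rewrite -expr2; lra.
Qed.

Lemma fdot_young d (H : 'M[R]_d) (x y : 'cV[R]_d) : H^T = H ->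
  (forall z : 'cV[R]_d, 0 <= fdot z (H *m z)) ->
  2 * fdot x (H *m y) <= fdot x (H *m x) + fdot y (H *m y).
Proof.
move=> HT H0; have := H0 (x + (-1) *: y).
rewrite !(mulmxDr, fdotDl, fdotDr) -!scalemxAr !(fdotZl, fdotZr).
have -> : fdot y (H *m x) = fdot x (H *m y) by rewrite fdotC fdot_mull HT.
lra.
Qed.

Context {p q n : nat}.
Variables (Y : 'I_n -> 'M[R]_(q, p)) (gT gP : R).
Hypotheses (gT0 : 0 <= gT) (gP0 : 0 <= gP).
Variables (To : 'M[R]_p) (Po : 'M[R]_q).
Hypothesis opt : is_optimum Y gT gP To Po.
Variables m b : R.
Hypotheses (m0 : 0 < m) (b0 : 0 < b).
Let Xo := kron_sum To Po.
Hypothesis Xo_wc : well_conditioned m b Xo.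
Let k := (p * q)%:R / m.
Let l := m / b ^+ 2.
Let k0 : 0 <= k. Proof. by rewrite divr_ge0 ?ler0n ?ltW. Qed.
Let l0 : 0 < l. Proof. by rewrite divr_gt0 ?exprn_gt0. Qed.
Let f := objective Y gT gP.
Let h := @penalty R p q gT gP.

(** The first-order condition at the optimum cancels the linear terms, leaving the strong concavity
    gap of log det. *)
Lemma objective_growth T P : feasible T P -> well_conditioned m b (kron_sum T P) ->
  l ^+ 2 / 4 * fnorm (kron_sum T P - Xo) ^+ 2 <= f T P - f To Po.
Proof.
move=> zf wc; have := optimum_variational gT0 gP0 opt zf.
have := ln_det_strongly_concave m0 b0 Xo_wc wc.
rewrite /f !objectiveE -/h -/l /dsmooth -/Xo kron_sumB -/Xo.
have -> : data_lin Y (T - To) (P - Po) = data_lin Y T P - data_lin Y To Po.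
  by rewrite -{2}(subrK To T) -{2}(subrK Po P) [in RHS]data_linD addrK.
lra.
Qed.

(** * A full step measured against a suitably shifted optimum *)

Section OneStep.
Variables (T : 'M[R]_p) (P : 'M[R]_q) (H : 'M[R]_(p * p + q * q))
  (DT : 'M[R]_p) (DP : 'M[R]_q).
Let X := kron_sum T P.
Let X' := kron_sum (T + DT) (P + DP).
Hypothesis X_wc : well_conditioned m b X.
Hypothesis z'_feasible : feasible (T + DT) (P + DP).
Hypothesis H_sym : H^T = H.
Hypothesis newton : newton_direction Y gT gP H T P DT DP.
Let A := To - T.
Let B := Po - P.
Hypotheses (A_supp : supported (active_Theta Y gT T P) A)
  (B_supp : supported (active_Psi Y gP T P) B).
(** [e] is the error before the step, [v] the step and [w] the error after it; [E] and [M] are the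
    Kronecker sums of [e] and [w]. *)
Let e := vec2 A B.
Let v := vec2 DT DP.
Let w := vec2 (A - DT) (B - DP).
Let E := Xo - X.
Let M := Xo - X'.
Let W := invmx X.
Let Wo := invmx Xo.

Let X_pd : posdef X. Proof. by case: X_wc. Qed.
Let Xo_pd : posdef Xo. Proof. by case: Xo_wc. Qed.
Let X'_pd : posdef X'. Proof. by case: z'_feasible. Qed.

Let kron_e : kron_sum A B = E. Proof. exact: kron_sumB. Qed.
Let kron_w : kron_sum (A - DT) (B - DP) = M.
Proof. by rewrite /A /B -!addrA -!opprD kron_sumB. Qed.
Let e_split : e = v + w.
Proof. by rewrite -vec2D ![_ + (_ - _)]addrC !subrK. Qed.
Let TA : T + A = To. Proof. by rewrite addrC subrK. Qed.
Let PB : P + B = Po. Proof. by rewrite addrC subrK. Qed.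

(** Since [e] is supported on the active sets, the optimum itself is an admissible competitor in the
    restricted model. *)
Lemma model_variational :
  0 <= dsmooth Y W (A - DT) (B - DP) + fdot v (H *m w)
       + (h To Po - h (T + DT) (P + DP)).
Proof.
have := newton_variational gT0 gP0 H_sym newton A_supp B_supp.
by rewrite TA PB fdot_vec_grad // X_pd.1.
Qed.

(* Adding the first-order conditions of the model and of the optimum cancels
   the penalty. *)
Lemma newton_error : fdot w (H *m w) <= fdot e (H *m w) - \tr (W *m E *m Wo *m M).
Proof.
have := model_variational; have := optimum_variational gT0 gP0 opt z'_feasible.
have -> : T + DT - To = -1 *: (A - DT).
  by rewrite scaleN1r !opprB addrCA addrA.
have -> : P + DP - Po = -1 *: (B - DP).
  by rewrite scaleN1r !opprB addrCA addrA.
rewrite dsmoothZ -/Xo -/Wo -/h e_split fdotDl /dsmooth kron_w.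
have : \tr (W *m M) - \tr (Wo *m M) = \tr (W *m E *m Wo *m M).
  by rewrite -raddfB /= -mulmxBl inv_sub ?posdef_unit.
lra.
Qed.

(** In [newton_error] the left side is at least [l ^+ 2 * fnorm M ^+ 2], and the resolvent identity
    makes the right side at most [k ^+ 3 * fnorm E ^+ 2 * fnorm M]; one factor [fnorm M] then
    cancels. *)
Lemma exact_step : exact_hessian T P H ->
  fnorm (X' - Xo) <= k ^+ 3 / l ^+ 2 * fnorm (X - Xo) ^+ 2.
Proof.
move=> Hex; rewrite (fnormBC X') (fnormBC X) -/M -/E.
have MT : M^T = M by rewrite linearB /= Xo_pd.1 X'_pd.1.
have ET : E^T = E by rewrite linearB /= Xo_pd.1 X_pd.1.
have [Wk Wl] := well_conditioned_inv m0 b0 X_wc; rewrite -/k -/l -/W in Wk Wl.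
have [Wok _] := well_conditioned_inv m0 b0 Xo_wc; rewrite -/k -/Wo in Wok.
have cyc (N : 'M[R]_(p * q)) : \tr (N *m (W *m M *m W)) = \tr (W *m N *m W *m M).
  by rewrite mulmxA mxtrace_mulC !mulmxA.
have := newton_error; rewrite !(exact_hessianE _ _ _ _ X_pd Hex) kron_e kron_w MT ET !cyc.
move=> le1.
have le2 : \tr (W *m M *m W *m M) <= \tr (W *m E *m W *m E *m Wo *m M).
  have -> : W *m E *m W *m E *m Wo = W *m E *m W - W *m E *m Wo.
    by rewrite -mulmxBr inv_sub ?posdef_unit // !mulmxA.
  by rewrite [in leRHS]mulmxBl [in leRHS]raddfB /=; lra.
have lo := tr_sandwich_ge (ltW l0) (ltW l0) Wl Wl (posdef_inv m0 b0 X_wc) MT.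
have up : \tr (W *m E *m W *m E *m Wo *m M) <= k ^+ 3 * fnorm E ^+ 2 * fnorm M.
  apply: le_trans (trmul_le _ _) _; rewrite ler_wpM2r ?fnorm_ge0 //.
  apply: le_trans (fnormM _ _) _.
  have -> : k ^+ 3 * fnorm E ^+ 2 = k * fnorm E * k * fnorm E * k by ring.
  by do 4!(apply: ler_pM; rewrite ?mulr_ge0 ?fnorm_ge0 //;
    try (apply: le_trans (fnormM _ _) _)).
have M0 := fnorm_ge0 M.
have {lo up le1 le2} key := le_trans lo (le_trans le2 up).
have ll : 0 < l ^+ 2 by rewrite exprn_gt0.
rewrite -expr2 in key; rewrite mulrAC ler_pdivlMr //.
have [M00|Mn0] := eqVneq (fnorm M) 0.
  by rewrite M00 mul0r mulr_ge0 ?exprn_ge0 ?fnorm_ge0.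
have M1 : 0 < fnorm M by rewrite lt_neqAle eq_sym Mn0.
rewrite -(ler_pM2r M1); apply: le_trans key; rewrite expr2; lra.
Qed.

Variables c1 c2 : R.
Hypotheses (c1_gt0 : 0 < c1) (c2_ge0 : 0 <= c2).
Hypothesis H_coercive : coercive c1 H.
Hypothesis H_bounded : fdot e (H *m e) <= c2 * fnorm E ^+ 2.
(** Converts the form of [H] at [w] into a bound on [fnorm M ^+ 2], combining the norm of the
    Kronecker sum map with the coercivity of [H]. *)
Let c3 : R := (p * q * (p * q))%:R * 4 / c1.
Let kappa := c3 * (2 * k ^+ 2 + c2) + 1.

Let H_ge0 (z : 'cV[R]_(p * p + q * q)) : 0 <= fdot z (H *m z).
Proof. by apply: le_trans (H_coercive z); rewrite mulr_ge0 ?sqr_ge0 ?ltW. Qed.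

Let c3_ge0 : 0 <= c3.
Proof. by rewrite divr_ge0 ?mulr_ge0 ?ler0n ?ltW. Qed.

(** Young's inequality absorbs half of the form at [w] into the left side of [newton_error], leaving
    a quadratic inequality between [fnorm M] and [fnorm E]. *)
Lemma approx_step_size : fnorm (X' - Xo) <= kappa * fnorm (X - Xo).
Proof.
rewrite (fnormBC X') (fnormBC X) -/M -/E.
have [Wk _] := well_conditioned_inv m0 b0 X_wc; rewrite -/k -/W in Wk.
have [Wok _] := well_conditioned_inv m0 b0 Xo_wc; rewrite -/k -/Wo in Wok.
set x := fnorm E; set y := fnorm M.
have x0 : 0 <= x by exact: fnorm_ge0.
have y0 : 0 <= y by exact: fnorm_ge0.
have lo : - (k ^+ 2 * x * y) <= \tr (W *m E *m Wo *m M).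
  rewrite lerNl -raddfN /= -mulmxN; apply: le_trans (tr4_le _ _ _ _) _.
  rewrite fnormN -/x -/y ler_wpM2r //.
  have -> : k ^+ 2 * x = k * x * k by ring.
  by rewrite !ler_pM ?mulr_ge0 ?fnorm_ge0.
have Hw : fdot w (H *m w) <= (2 * k ^+ 2 * x * y) + c2 * x ^+ 2.
  have := fdot_young e w H_sym H_ge0; have := newton_error; move: H_bounded.
  rewrite -/x; lra.
have : y ^+ 2 <= c3 * (2 * k ^+ 2 * x * y + c2 * x ^+ 2).
  apply: le_trans (ler_wpM2l c3_ge0 Hw).
  have := fnorm_kron_sum (A - DT) (B - DP); rewrite kron_w -/w -/y => /le_trans; apply.
  rewrite /c3 -[leRHS]mulrA ler_wpM2l ?mulr_ge0 ?ler0n //.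
  by rewrite mulrC ler_pdivlMr // mulrC.
have a0 : 0 <= c3 * (2 * k ^+ 2) by rewrite (mulr_ge0 c3_ge0) // mulr_ge0 ?exprn_ge0.
have b0' : 0 <= c3 * c2 by rewrite (mulr_ge0 c3_ge0).
have -> : c3 * (2 * k ^+ 2 * x * y + c2 * x ^+ 2) =
  (c3 * (2 * k ^+ 2)) * x * y + c3 * c2 * x ^+ 2 by ring.
rewrite /kappa mulrDr; move: (c3 * (2 * _)) (c3 * c2) a0 b0' => a c a0 b0' quad.
(* If [y] exceeded [(a + c + 1) * x], then [x <= y] and the right side would be at most
   [(a + c) * x * y], which is too small for [y ^+ 2]. *)
rewrite leNgt; apply/negP => ylt.
have ax := mulr_ge0 a0 x0; have cx := mulr_ge0 b0' x0.
have yx : x <= y by lra.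
have cxy : c * x ^+ 2 <= c * x * y by rewrite expr2 mulrA ler_wpM2l.
have y1 : 0 < y by lra.
have : (a + c + 1) * x * y < y * y by rewrite ltr_pM2r.
nra.
Qed.

(** Tangents of log det at [X'] and [X] are added to [model_variational]. What remains is the change
    of the inverse along [D], quadratic in [D], and the form pairing [v] with [w], which Young's
    inequality bounds through [e]. *)
Lemma approx_step_value : well_conditioned m b X' ->
  f (T + DT) (P + DP) - f To Po
  <= (k ^+ 2 * (1 + kappa) ^+ 2 + c2) * fnorm (X - Xo) ^+ 2.
Proof.
move=> X'_wc; have := approx_step_size.
have [Wk _] := well_conditioned_inv m0 b0 X_wc; rewrite -/k -/W in Wk.
have [W'k _] := well_conditioned_inv m0 b0 X'_wc; rewrite -/k in W'k.
set W' := invmx X' in W'k; set D := X' - X.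
rewrite (fnormBC X') (fnormBC X) -/M -/E => M_le.
have x0 := fnorm_ge0 E; have d0 := fnorm_ge0 D.
have D_le : fnorm D <= (1 + kappa) * fnorm E.
  have -> : D = E - M by rewrite /D /E /M opprB [RHS]addrC subrKA.
  by have := fnormD E (- M); rewrite fnormN; lra.
have t1 := ln_det_tangent X'_pd X_pd; have t2 := ln_det_tangent X_pd Xo_pd.
have XX' : X - X' = - D by rewrite opprB.
rewrite -/W' XX' mulmxN raddfN /= in t1; rewrite -/W -/E in t2.
have up : \tr (W *m D) - \tr (W' *m D) <= k ^+ 2 * (1 + kappa) ^+ 2 * fnorm E ^+ 2.
  rewrite -raddfB /= -mulmxBl inv_sub ?posdef_unit // -/D.
  apply: le_trans (tr4_le _ _ _ _) _.
  have -> : k ^+ 2 * (1 + kappa) ^+ 2 * fnorm E ^+ 2 =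
    k * ((1 + kappa) * fnorm E) * k * ((1 + kappa) * fnorm E) by ring.
  by rewrite !ler_pM ?mulr_ge0 ?fnorm_ge0.
have := model_variational; rewrite /dsmooth kron_w.
have : fdot v (H *m w) <= c2 * fnorm E ^+ 2.
  have := fdot_young e w H_sym H_ge0; move: H_bounded (H_ge0 w) (H_ge0 e).
  by rewrite e_split !fdotDl; lra.
have -> : data_lin Y (A - DT) (B - DP) =
    data_lin Y To Po - data_lin Y (T + DT) (P + DP).
  have := data_linD Y (A - DT) (B - DP) (T + DT) (P + DP).
  have -> : A - DT + (T + DT) = To by rewrite addrACA addNr addr0 subrK.
  have -> : B - DP + (P + DP) = Po by rewrite addrACA addNr addr0 subrK.
  lra.
have -> : \tr (W *m M) = \tr (W *m E) - \tr (W *m D).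
  by rewrite -raddfB /= -mulmxBr /D /E /M; congr (\tr (_ *m _)); rewrite opprB addrA subrK.
rewrite /f !objectiveE -/h -/Xo -/X' mulrDl; lra.
Qed.

Let mu := l ^+ 2 / 4.
Let s := (1 + c2 / (2 * mu))^-1.

(** The competitor is only the fraction [s] of the offset to the optimum. By convexity it gains [s]
    times the gap in value, and the growth estimate with this choice of [s] limits the Hessian term
    to half of that gain. *)
Lemma approx_step_slope : feasible T P ->
  fdot v (vec_grad Y T P) + h (T + DT) (P + DP) - h T P
  <= - (s / 2 * (f T P - f To Po)).
Proof.
move=> zf; have mu0 : 0 < mu by rewrite divr_gt0 ?exprn_gt0.
have growth := objective_growth zf X_wc; rewrite -/mu -/X (fnormBC X) -/E in growth.
have cm : 0 <= c2 / (2 * mu) by rewrite divr_ge0 // mulr_ge0 // ltW.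
have s0 : 0 < s by rewrite invr_gt0 ltr_pwDl.
have s1 : s <= 1 by rewrite invf_le1 ?ltr_pwDl // lerDl.
have sE : s * (1 + c2 / (2 * mu)) = 1 by rewrite mulVf // gt_eqF ?ltr_pwDl.
have s01 : 0 <= s <= 1 by rewrite ltW.
have sA : supported (active_Theta Y gT T P) (s *: A).
  by move=> i j ij; rewrite mxE A_supp ?mulr0.
have sB : supported (active_Psi Y gP T P) (s *: B).
  by move=> i j ij; rewrite mxE B_supp ?mulr0.
have := newton_variational gT0 gP0 H_sym newton sA sB.
have -> : vec2 (s *: A - DT) (s *: B - DP) = s *: e + (-1) *: v.
  by rewrite -!vec2Z -vec2D !scaleN1r.
have pen := penalty_convex gT0 gP0 T P To Po s01; rewrite -/h -/A -/B in pen *.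
rewrite !(mulmxDr, fdotDr) -!scalemxAr !fdotZr (fdotC _ v) fdot_vec_grad; last exact: X_pd.1.
rewrite -/v -/W /dsmooth kron_e.
have t := ln_det_tangent X_pd Xo_pd; rewrite -/W -/E in t.
have lin : data_lin Y A B = data_lin Y To Po - data_lin Y T P.
  have := data_linD Y T P A B; rewrite TA PB; lra.
have young : s * fdot v (H *m e) <= fdot v (H *m v) + s ^+ 2 / 4 * fdot e (H *m e).
  have := fdot_young (2 *: v) (s *: e) H_sym H_ge0.
  rewrite -!scalemxAr !(fdotZl, fdotZr); lra.
have Hs : s ^+ 2 / 4 * fdot e (H *m e) <= s / 2 * (f T P - f To Po).
  apply: le_trans (_ : s ^+ 2 / 4 * (c2 / mu * (f T P - f To Po)) <= _).
    apply: ler_wpM2l; first by rewrite divr_ge0 // sqr_ge0.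
    apply: le_trans H_bounded _.
    by rewrite -mulrA ler_wpM2l // mulrC ler_pdivlMr // mulrC.
  have f0 : 0 <= f T P - f To Po.
    by apply: le_trans growth; rewrite mulr_ge0 ?sqr_ge0 // ltW.
  have -> : s ^+ 2 / 4 * (c2 / mu * (f T P - f To Po)) =
      s / 2 * (s * (c2 / (2 * mu))) * (f T P - f To Po).
    by field; rewrite gt_eqF.
  rewrite ler_wpM2r // ler_piMr //; first by rewrite divr_ge0 // ltW.
  by rewrite -[leRHS]sE mulrDr mulr1 lerDr ltW.
have key : s * (data_lin Y A B - \tr (W *m E) + (h To Po - h T P)) <=
    - (s * (f T P - f To Po)).
  rewrite -mulrN ler_wpM2l ?(ltW s0) // lin /f !objectiveE -/h -/X -/Xo; lra.
lra.
Qed.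

End OneStep.
End NewtonStep.

(** * Local convergence *)

Section Sequences.
Context {R : realType}.

(** Below [r] one has [C * x t <= 2^-1], so each step at least halves the error; this both preserves
    the smallness and yields convergence. *)
Lemma quadratic_contraction (x : nat -> R) C r :
  (forall t, 0 <= x t) -> 0 <= C -> r * (2 * (1 + C)) <= 1 -> x 0%N < r ->
  (forall t, x t < r -> x t.+1 <= C * x t ^+ 2) ->
  (forall t, x t < r) /\ x t @[t --> \oo] --> (0 : R).
Proof.
move=> x0 C0 rC x0r step.
have half t : x t < r -> x t.+1 <= 2^-1 * x t.
  move=> xr; apply: le_trans (step t xr) _; rewrite expr2 mulrA ler_wpM2r //.
  have := x0 t; nra.
have small t : x t < r.
  by elim: t => // t IH; apply: le_lt_trans (half t IH) _; have := x0 t; lra.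
split=> //.
have geo t : x t <= geometric (x 0%N) 2^-1 t.
  elim: t => [|t IH]; first by rewrite /= expr0 mulr1.
  by apply: le_trans (half t (small t)) _; move: IH; rewrite /= exprS mulrCA; lra.
apply: (@squeeze_cvgr _ _ _ _ (fun=> 0) (geometric (x 0%N) 2^-1)).
- by apply: nearW => t; rewrite x0 geo.
- exact: cvg_cst.
- by apply: cvg_geometric; rewrite ger0_norm //; lra.
Qed.

(** The distance is controlled by the square root of the gap [D], whence the rate [Num.sqrt rho].
    The bound of [D s.+1] by [x s] returns from values to distances, using up one step. *)
Lemma linear_from_values (x D : nat -> R) mu C rho :
  (forall t, 0 <= x t) -> 0 < mu -> 0 <= C -> 0 < rho < 1 ->
  (forall t, mu * x t ^+ 2 <= D t) -> (forall t, D t.+1 <= C * x t ^+ 2) ->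
  (forall t, D t.+1 <= rho * D t) ->
  exists M rho' : R, 0 <= rho' < 1 /\
    forall s t, x (s + t)%N <= M * rho' ^+ t * x s.
Proof.
move=> x0 mu0 C0 /andP[rho0 rho1] lo up dec.
have k0 : 0 <= C / (mu * rho) by rewrite divr_ge0 // ltW // mulr_gt0.
(* The summand [1] covers [t = 0]; for later steps the square of the constant must dominate
   [C / (mu * rho)], where [rho] compensates the step used up. *)
exists (1 + C / (mu * rho)), (Num.sqrt rho); split.
  by rewrite sqrtr_ge0 -sqrtr1 ltr_sqrt.
move=> s [|t]; first by rewrite addn0 expr0 mulr1 ler_peMl // lerDl.
have Dt u : D (s + u.+1)%N <= rho ^+ u * (C * x s ^+ 2).
  elim: u => [|u IH]; first by rewrite addn1 mul1r.
  by rewrite addnS (le_trans (dec _)) // exprS -mulrA ler_wpM2l // ltW.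
rewrite -(@ler_pXn2r _ 2) ?nnegrE ?mulr_ge0 ?exprn_ge0 ?sqrtr_ge0 ?addr_ge0 //.
rewrite !exprMn -exprM mulnC exprM sqr_sqrtr ?(ltW rho0) //.
rewrite -(ler_pM2l mu0); apply: le_trans (lo _) _; apply: le_trans (Dt t) _.
have -> : mu * ((1 + C / (mu * rho)) ^+ 2 * rho ^+ t.+1 * x s ^+ 2) =
    rho ^+ t * ((mu * rho * (1 + C / (mu * rho)) ^+ 2) * x s ^+ 2).
  by rewrite [rho ^+ t.+1]exprS; move: (C / _) => z; ring.
rewrite ler_wpM2l ?exprn_ge0 ?(ltW rho0) // ler_wpM2r ?sqr_ge0 //.
have mr0 : 0 < mu * rho by rewrite mulr_gt0.
have {1}-> : C = mu * rho * (C / (mu * rho)) by field; rewrite !gt_eqF.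
rewrite ler_wpM2l ?(ltW mr0) //; move: (C / _) k0 => y y0; nra.
Qed.

End Sequences.

(** * One-iteration estimates, uniform near the optimum *)

Section LocalConvergence.
Context {R : realType} {p q n : nat}.
Hypotheses (p0 : (0 < p)%N) (q0 : (0 < q)%N) (n0 : (0 < n)%N).
Variables (Y : 'I_n -> 'M[R]_(q, p)) (gT gP : R).
Hypotheses (gT0 : 0 <= gT) (gP0 : 0 <= gP).
Variables (To : 'M[R]_p) (Po : 'M[R]_q).
Hypothesis opt : is_optimum Y gT gP To Po.
Let Xo := kron_sum To Po.
Let f := objective Y gT gP.

(** The line search tests only the Kronecker sum; its symmetry passes to the factors because their
    off-diagonal entries occur in it. *)
Lemma feasible_posdef (T : 'M[R]_p) (P : 'M[R]_q) :
  posdef (kron_sum T P) -> feasible T P.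
Proof.
move=> Xpd; split=> //; apply/matrixP => i j; rewrite mxE.
  have [->//|ij] := eqVneq i j; rewrite -(kron_sum_offl T P (Ordinal q0) ij).
  by rewrite -Xpd.1 mxE kron_sum_offl // eq_sym.
have [->//|ij] := eqVneq i j; rewrite -(kron_sum_offr T P (Ordinal p0) ij).
by rewrite -Xpd.1 mxE kron_sum_offr // eq_sym.
Qed.

Lemma run_feasible hess sigma beta (T : nat -> 'M[R]_p) (P : nat -> 'M[R]_q) alpha :
  eiglasso_run Y gT gP sigma beta hess T P alpha -> forall t, feasible (T t) (P t).
Proof.
move=> [T0 P0 run] [|t]; apply: feasible_posdef.
  have -> : kron_sum (T 0%N) (P 0%N) = 2 *: 1%:M.
    by rewrite /kron_sum T0 P0 tens1 scaler_nat.
  apply: (@coercive_posdef _ _ 2) => // [|x]; first by rewrite linearZ /= trmx1.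
  by rewrite -scalemxAl mul1mx fdotZr fdot_sq.
have [H [DT [DP [_ _ [m [-> [Xpd _] _]] -> ->]]]] := run t; exact: Xpd.
Qed.

Lemma optimum_shift_value c : f (To + c%:M) (Po - c%:M) = f To Po.
Proof.
have opt' := optimum_shift c p0 q0 n0 opt; apply/eqP; rewrite eq_le; apply/andP.
by split; [apply: opt'.2; exact: opt.1 | apply: opt.2; exact: opt'.1].
Qed.

Lemma shifted_optimum : exists m b r, [/\ 0 < m, 0 < b, 0 < r,
  well_conditioned m b Xo &
  forall (T : 'M[R]_p) (P : 'M[R]_q), feasible T P -> fnorm (kron_sum T P - Xo) < r ->
    well_conditioned m b (kron_sum T P) /\
    exists T' P', [/\ is_optimum Y gT gP T' P', kron_sum T' P' = Xo,
      f T' P' = f To Po,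
      supported (active_Theta Y gT T P) (T' - T) /\
      supported (active_Psi Y gP T P) (P' - P)
    & fnorm (vec2 (T' - T) (P' - P)) ^+ 2
        <= ((p * p + q * q) * 1)%:R * 4 * fnorm (Xo - kron_sum T P) ^+ 2]].
Proof.
have [_ _ Xopd] := opt.1.
have [m [b [m0 b0 near]]] := well_conditioned_near Xopd.
have [r r0 gauge] := optimum_gauge p0 q0 To Po.
exists m, b, (Num.min m r); split=> //; first by rewrite lt_min m0.
  by apply: near => //; rewrite subrr -(scale0r 0) fnormZ normr0 mul0r ltW.
move=> T P [_ _ Xpd]; rewrite lt_min => /andP[Xm Xr].
split; first by apply: near => //; exact: ltW.
have [c [cT cP cE]] := gauge T P Xpd Xr.
exists (To + c%:M), (Po - c%:M); split.
- exact: optimum_shift.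
- exact: kron_sum_shift.
- exact: optimum_shift_value.
(* An inactive entry is zero in the current factor, which is exactly where the gauge guarantees a
   zero of the difference. *)
- by split=> i j; rewrite negb_or negbK => /andP[/eqP ij _]; [exact: cT | exact: cP].
- by move: cE; rewrite kron_sumB kron_sum_shift.
Qed.

Lemma exact_local : exists C r, [/\ 0 <= C, 0 < r &
  forall (T DT : 'M[R]_p) (P DP : 'M[R]_q) H,
    feasible T P -> feasible (T + DT) (P + DP) -> exact_hessian T P H ->
    newton_direction Y gT gP H T P DT DP -> fnorm (kron_sum T P - Xo) < r ->
    fnorm (kron_sum (T + DT) (P + DP) - Xo) <= C * fnorm (kron_sum T P - Xo) ^+ 2].
Proof.
have [m [b [r [m0 b0 r0 wco near]]]] := shifted_optimum.
exists (((p * q)%:R / m) ^+ 3 / (m / b ^+ 2) ^+ 2), r; split=> //.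
  by rewrite divr_ge0 ?sqr_ge0 ?exprn_ge0 ?divr_ge0 ?ler0n ?(ltW m0).
move=> T DT P DP H zf zf' Hex newton Xr.
have [wc [T' [P' [opt' XE _ [sT sP] _]]]] := near T P zf Xr.
have Hs : H^T = H by apply: exact_hessian_tr Hex; case: zf.
have wco' : well_conditioned m b (kron_sum T' P') by rewrite XE.
by have := exact_step gT0 gP0 opt' m0 b0 wco' wc zf' Hs newton sT sP Hex; rewrite XE.
Qed.

Lemma approx_local K : (1 <= K)%N -> (K <= p)%N -> (K <= q)%N ->
  exists kappa mu C c r, [/\ [/\ 1 <= kappa, 0 < mu, 0 <= C, 0 < c <= 2^-1 & 0 < r] &
  forall (T DT : 'M[R]_p) (P DP : 'M[R]_q) H,
    feasible T P -> feasible (T + DT) (P + DP) -> approx_hessian K T P H ->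
    newton_direction Y gT gP H T P DT DP -> fnorm (kron_sum T P - Xo) < r ->
    [/\ mu * fnorm (kron_sum T P - Xo) ^+ 2 <= f T P - f To Po,
     fnorm (kron_sum (T + DT) (P + DP) - Xo) <= kappa * fnorm (kron_sum T P - Xo),
     fnorm (kron_sum (T + DT) (P + DP) - Xo) < r ->
       f (T + DT) (P + DP) - f To Po <= C * fnorm (kron_sum T P - Xo) ^+ 2
   & fdot (vec2 DT DP) (vec_grad Y T P) + penalty gT gP (T + DT) (P + DP)
       - penalty gT gP T P <= - (c * (f T P - f To Po))]].
Proof.
move=> K0 Kp Kq; have [m [b [r [m0 b0 r0 wco near]]]] := shifted_optimum.
pose c1 := b ^- 2; have c1_0 : 0 < c1 by rewrite invr_gt0 exprn_gt0.
(* The upper bound of the approximate Hessian times the gauge constant that passes from the pair of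
   factors to its Kronecker sum. *)
pose c2 := (p + q)%:R / m ^+ 2 * (((p * p + q * q) * 1)%:R * 4) : R.
have c2_0 : 0 <= c2.
  by rewrite mulr_ge0 ?divr_ge0 ?mulr_ge0 ?exprn_ge0 ?ler0n ?(ltW m0).
pose k := (p * q)%:R / m; have k0 : 0 <= k by rewrite divr_ge0 ?ler0n ?(ltW m0).
pose mu := (m / b ^+ 2) ^+ 2 / 4.
have mu0 : 0 < mu by rewrite divr_gt0 ?exprn_gt0 ?divr_gt0 ?exprn_gt0.
pose kappa := (p * q * (p * q))%:R * 4 / c1 * (2 * k ^+ 2 + c2) + 1.
pose C := k ^+ 2 * (1 + kappa) ^+ 2 + c2.
pose c := (1 + c2 / (2 * mu))^-1 / 2.
exists kappa, mu, C, c, r; split.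
  have kk : 0 <= 2 * k ^+ 2 + c2 by rewrite addr_ge0 // mulr_ge0 ?exprn_ge0.
  have kappa1 : 1 <= kappa.
    by rewrite lerDr mulr_ge0 // divr_ge0 ?mulr_ge0 ?ler0n ?(ltW c1_0).
  have cm : 0 <= c2 / (2 * mu) by rewrite divr_ge0 // mulr_ge0 // (ltW mu0).
  split=> //.
    by rewrite addr_ge0 // mulr_ge0 ?sqr_ge0.
  rewrite divr_gt0 ?invr_gt0 ?ltr_pwDl //= ler_piMl // ?invf_le1 ?ltr_pwDl // lerDl //.
move=> T DT P DP H zf zf' Hap newton Xr.
have [wc [T' [P' [opt' XE fE [sT sP] eE]]]] := near T P zf Xr.
have wco' : well_conditioned m b (kron_sum T' P') by rewrite XE.
have [_ Xm Xb] := wc.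
have [Hs Hlo Hup] := approx_hessian_bounds K0 Kp Kq m0 Xm Xb Hap.
have He : fdot (vec2 (T' - T) (P' - P)) (H *m vec2 (T' - T) (P' - P))
    <= c2 * fnorm (kron_sum T' P' - kron_sum T P) ^+ 2.
  apply: le_trans (Hup _) _; rewrite XE /c2 -[leRHS]mulrA ler_wpM2l //.
  by rewrite divr_ge0 ?ler0n ?exprn_ge0 ?(ltW m0).
rewrite -fE -XE; split.
- exact: (objective_growth gT0 gP0 opt' m0 b0 wco' zf wc).
- exact: (approx_step_size gT0 gP0 opt' m0 b0 wco' wc zf' Hs newton sT sP c1_0 c2_0 Hlo He).
- rewrite XE => X'r; have [wc' _] := near _ _ zf' X'r; rewrite -XE.
  exact: (approx_step_value gT0 gP0 opt' m0 b0 wco' wc zf' Hs newton sT sP c1_0 c2_0 Hlo He wc').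
- exact: (approx_step_slope gT0 gP0 opt' m0 b0 wco' wc Hs newton sT sP c1_0 c2_0 Hlo He zf).
Qed.

End LocalConvergence.

(** * Assembling the local estimates along a run *)

Theorem theorem13 (R : realType) (p q n K : nat)
  (p_ge1 : (1 <= p)%N) (q_ge1 : (1 <= q)%N) (n_ge1 : (1 <= n)%N)
  (K_ge1 : (1 <= K)%N) (K_le_p : (K <= p)%N) (K_le_q : (K <= q)%N)
  (Y : 'I_n -> 'M[R]_(q, p)) (gT gP : R) (gT_ge0 : 0 <= gT) (gP_ge0 : 0 <= gP)
  (sigma beta : R) (sigma_bnd : 0 < sigma < 2^-1) (beta_bnd : 0 < beta < 1)
  (Theta_opt : 'M[R]_p) (Psi_opt : 'M[R]_q)
  (opt : is_optimum Y gT gP Theta_opt Psi_opt) :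
  (exists2 r : R, 0 < r &
    forall (Theta : nat -> 'M[R]_p) (Psi : nat -> 'M[R]_q) (alpha : nat -> R)
      (t0 : nat),
      eiglasso_run Y gT gP sigma beta (@exact_hessian R p q) Theta Psi alpha ->
      frob (kron_sum (Theta t0) (Psi t0) - kron_sum Theta_opt Psi_opt) < r ->
      (forall t, (t0 <= t)%N -> alpha t = 1) ->
      quadratic_cvg (fun t => kron_sum (Theta (t0 + t)%N) (Psi (t0 + t)%N))
        (kron_sum Theta_opt Psi_opt)) /\
  (exists2 r : R, 0 < r &
    forall (Theta : nat -> 'M[R]_p) (Psi : nat -> 'M[R]_q) (alpha : nat -> R)
      (t0 : nat),
      eiglasso_run Y gT gP sigma beta (@approx_hessian R p q K)
        Theta Psi alpha ->
      frob (kron_sum (Theta t0) (Psi t0) - kron_sum Theta_opt Psi_opt) < r ->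
      (forall t, (t0 <= t)%N -> alpha t = 1) ->
      linear_cvg (fun t => kron_sum (Theta (t0 + t)%N) (Psi (t0 + t)%N))
        (kron_sum Theta_opt Psi_opt) /\
      qlinear_cvg
        (fun t => objective Y gT gP (Theta (t0 + t)%N) (Psi (t0 + t)%N))
        (objective Y gT gP Theta_opt Psi_opt)).
Proof.
split.
  have [C [r [C0 r0 step]]] := exact_local p_ge1 q_ge1 n_ge1 gT_ge0 gP_ge0 opt.
  have D0 : 0 < 2 * (1 + C) by rewrite mulr_gt0 // ltr_pwDl.
  exists (Num.min r (2 * (1 + C))^-1); first by rewrite lt_min r0 invr_gt0.
  move=> T P alpha t0 run close unit_step.
  have feas := run_feasible p_ge1 q_ge1 run; have [_ _ next] := run.
  pose x t :=
    fnorm (kron_sum (T (t0 + t)%N) (P (t0 + t)%N) - kron_sum Theta_opt Psi_opt).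
  have xstep t : x t < Num.min r (2 * (1 + C))^-1 -> x t.+1 <= C * x t ^+ 2.
    rewrite lt_min /x addnS => /andP[xr _].
    have [H [DT [DP [hex newton _]]]] := next (t0 + t)%N.
    rewrite unit_step ?leq_addr // !scale1r => TE PE.
    have := feas (t0 + t).+1; rewrite TE PE => zf'.
    exact: step (feas _) zf' hex newton xr.
  have x0 t : 0 <= x t by exact: fnorm_ge0.
  have rC : Num.min r (2 * (1 + C))^-1 * (2 * (1 + C)) <= 1.
    by rewrite -ler_pdivlMr // div1r ge_min lexx orbT.
  have start : x 0%N < Num.min r (2 * (1 + C))^-1 by rewrite /x addn0.
  have [small cvg] := quadratic_contraction x0 C0 rC start xstep.
  by split; [exact: cvg | exists C => t; exact: xstep].
have [kappa [mu [C [c [r [[kappa1 mu0 C0 c01 r0] step]]]]]] :=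
  approx_local p_ge1 q_ge1 n_ge1 gT_ge0 gP_ge0 opt K_ge1 K_le_p K_le_q.
have /andP[c0 c1] := c01; have /andP[sigma0 sigma1] := sigma_bnd.
have kappa0 : 0 < kappa by lra.
(* A step may enlarge the distance by [kappa]; from the ball of radius [r1] it still lands within
   [r / 2], where the local estimates hold. *)
pose r1 := r / (2 * kappa).
have r1_0 : 0 < r1 by rewrite divr_gt0 // mulr_gt0.
have r1kappa : kappa * r1 < r.
  have -> : kappa * r1 = r / 2 by rewrite /r1; field; rewrite gt_eqF.
  lra.
have r1r : r1 < r by nra.
have muC : 0 < mu + C by lra.
(* Shrinks the starting ball so that [C * (r1 * g) ^+ 2 <= mu * r1 ^+ 2]: the value after the first
   step is then low enough for growth to keep the iterates within [r1]. *)
pose g := mu / (mu + C).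
have g0 : 0 < g by rewrite divr_gt0.
have gE : g * (mu + C) = mu by rewrite mulfVK // gt_eqF.
have g1 : g <= 1 by rewrite ler_pdivrMr // mul1r lerDl.
exists (r1 * g); first by rewrite mulr_gt0.
move=> T P alpha t0 run close unit_step.
have feas := run_feasible p_ge1 q_ge1 run; have [_ _ next] := run.
pose Xo := kron_sum Theta_opt Psi_opt.
pose x t := fnorm (kron_sum (T (t0 + t)%N) (P (t0 + t)%N) - Xo).
pose fo := objective Y gT gP Theta_opt Psi_opt.
pose D t := objective Y gT gP (T (t0 + t)%N) (P (t0 + t)%N) - fo.
have x0 t : 0 <= x t by exact: fnorm_ge0.
have D0 t : 0 <= D t by rewrite subr_ge0; exact: opt.2.
(* Sufficient decrease with unit step and the slope bound [- (c * D t)] give exactly this factor. *)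
pose rho := 1 - sigma * c.
have rho01 : 0 < rho < 1.
  have := mulr_gt0 sigma0 c0; have : sigma * c <= 2^-1 * 2^-1 by rewrite ler_pM // ltW.
  by rewrite /rho; move: (sigma * c) => z; lra.
have one t : x t < r ->
  [/\ mu * x t ^+ 2 <= D t, x t.+1 <= kappa * x t,
     x t.+1 < r -> D t.+1 <= C * x t ^+ 2 & D t.+1 <= rho * D t].
  move=> xr.
  have [H [DT [DP [hap newton [m [alphaE [_ armijo] _]]]]]] := next (t0 + t)%N.
  rewrite -alphaE in armijo; move: armijo; rewrite unit_step ?leq_addr //.
  rewrite !scale1r mul1r => armijo TE PE.
  have := feas (t0 + t).+1; rewrite TE PE => zf'.
  have [lo size value slope] := step _ _ _ _ _ (feas _) zf' hap newton xr.
  have DS : D t.+1 = objective Y gT gP (T (t0 + t)%N + DT) (P (t0 + t)%N + DP) - fo.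
    by rewrite /D addnS TE PE.
  have xS : x t.+1 = fnorm (kron_sum (T (t0 + t)%N + DT) (P (t0 + t)%N + DP) - Xo).
    by rewrite /x addnS TE PE.
  split=> //; [by rewrite xS | by rewrite xS DS |].
  have E : ((vec2 DT DP)^T *m vec_grad Y (T (t0 + t)%N) (P (t0 + t)%N)) 0 0 =
      fdot (vec2 DT DP) (vec_grad Y (T (t0 + t)%N) (P (t0 + t)%N)).
    by rewrite fdot_tr /mxtrace big_ord1.
  rewrite E in armijo.
  have := ler_wpM2l (ltW sigma0) slope; rewrite DS /rho /D -/fo; lra.
have xr t : x t <= r1 -> x t < r /\ x t.+1 < r.
  move=> xt; have xtr : x t < r by exact: le_lt_trans r1r.
  split=> //; have [_ size _ _] := one t xtr; apply: le_lt_trans size _.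
  by apply: le_lt_trans r1kappa; rewrite ler_wpM2l // ltW.
(* The distance need not decrease at each step, so the invariant is carried by the decreasing gap,
   from which growth recovers the distance. It concerns [D t.+1] because [one] bounds by the
   distance only values reached after a step. *)
have inv t : x t <= r1 /\ D t.+1 <= mu * r1 ^+ 2.
  elim: t => [|t [xt Dt]].
    have xg : x 0%N < r1 * g by rewrite /x addn0.
    have xr1 : x 0%N <= r1 by nra.
    have [x0r x1r] := xr _ xr1; have [_ _ D1 _] := one _ x0r.
    split=> //; apply: le_trans (D1 x1r) _.
    apply: le_trans (_ : C * (r1 * g) ^+ 2 <= _).
      have rg0 : 0 <= r1 * g by rewrite mulr_ge0 // ltW.
      by rewrite ler_wpM2l // ler_pXn2r ?nnegrE ?x0 // ltW.
    rewrite exprMn mulrCA mulrC ler_wpM2r ?sqr_ge0 //; nra.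
  have [xtr xSr] := xr _ xt; have [lo _ _ D2] := one _ xSr.
  split.
    rewrite -(@ler_pXn2r _ 2) ?nnegrE ?(ltW r1_0) // -(ler_pM2l mu0).
    exact: le_trans Dt.
  apply: le_trans D2 _; apply: le_trans Dt; rewrite ler_piMl //.
  by have /andP[_ /ltW] := rho01.
have seq t : [/\ mu * x t ^+ 2 <= D t, D t.+1 <= C * x t ^+ 2 & D t.+1 <= rho * D t].
  by have [xtr xSr] := xr _ (inv t).1; have [? _ + ?] := one _ xtr; move=> /(_ xSr).
split.
  apply: (@linear_from_values _ x D mu C rho) => // t; by have [] := seq t.
exists rho; split; first by have /andP[/ltW -> ->] := rho01.
move=> t; rewrite -/fo !ger0_norm; [|exact: D0|exact: D0]; by have [] := seq t.
Qed.
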